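(* For all $\varepsilon \in (0,1]$, $\delta\in[0,1)$, $\alpha > 0$, $d\in \mathbb{N}$ with $d > 1$, all sufficiently large $T\in\mathbb{N}$, and all mechanisms $\mathcal{M}$ in the (nonadaptive) continual release model that are $(\varepsilon,\delta)$-differentially private and $(\alpha, T)$-accurate for $\mathrm{SumSelect}_d$, the following hold. (1) If $0<\delta = o(\varepsilon/T)$, then $\alpha =\tilde \Omega\Big(\min\Big\{\frac{T^{1/3} \log^{2/3} d}{\varepsilon^{2/3}},\ \frac{\sqrt{d}}{\varepsilon},\ T\Big\} \Big)$. (2) If $\delta = 0$, then $\alpha = \Omega\Big(\min\Big\{\sqrt{\tfrac{T}{\varepsilon}\log\big(2 + \tfrac{d}{\sqrt{\varepsilon T}}\big)},\ \frac {d}{\varepsilon},\ T\Big\}\Big) = \tilde \Omega \Big(\min\Big\{\sqrt{\tfrac{T\log d}{\varepsilon} },\ \frac d \varepsilon ,\ T\Big\}\Big)$.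
   Context: Records come from $\mathcal{X}=\{0,1\}^d$; $x_i[j]$ is the $j$-th coordinate of record $x_i$; $\vec x_{[t]}=(x_1,\dots,x_t)$. $\mathrm{MaxSum}_d(\vec x_{[t]})=\max_{j\in[d]}\sum_{i\le t}x_i[j]$, and $\mathrm{SumSelect}_d(\vec x_{[t]})$ is the (smallest) index $j$ attaining this maximum. The error of an answer $a\in[d]$ at time $t$ is $\mathrm{err}(\vec x_{[t]},a)=\mathrm{MaxSum}_d(\vec x_{[t]})-\sum_{i\le t}x_i[a]$. Continual release model (nonadaptive): a mechanism receives a stream $\vec x\in\mathcal{X}^T$ fixed in advance, one record per step, and outputs $a_t$ after receiving $x_t$. It is $(\alpha,T)$-accurate for $\mathrm{SumSelect}_d$ if for every fixed stream, $\Pr_{\text{coins of }\mathcal{M}}[\max_{t\in[T]}\mathrm{err}(\vec x_{[t]},a_t)\le\alpha]\ge 2/3$. It is $(\varepsilon,\delta)$-DP if the batch map from $\vec x$ to the whole output stream $(a_1,\dots,a_T)$ is $(\varepsilon,\delta)$-DP with respect to streams differing in one record. $\tilde\Omega$ hides polylogarithmic factors. *)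

(* Defs.v *)
From HB Require Import structures.
From mathcomp Require Import all_boot all_order all_algebra.
From mathcomp Require Import all_classical all_reals all_analysis.

Set Implicit Arguments.
Unset Strict Implicit.
Unset Printing Implicit Defensive.

Import Order.TTheory GRing.Theory Num.Theory.
Import numFieldNormedType.Exports.

Local Open Scope classical_set_scope.
Local Open Scope ring_scope.

Definition datum (d : nat) : Type := {ffun 'I_d -> bool}.

Definition coord_sum (d : nat) (s : seq (datum d)) (j : 'I_d) : nat :=
  (\sum_(x <- s) x j)%N.

Definition max_sum (d : nat) (s : seq (datum d)) : nat :=
  (\max_(j < d) coord_sum s j)%N.

(* The truncated subtraction is harmless: coord_sum s a <= max_sum s. *)
Definition err (d : nat) (s : seq (datum d)) (a : 'I_d) : nat :=
  (max_sum s - coord_sum s a)%N.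

(* A randomized online algorithm for streams of length T: the coins are drawn
   independently of the (fixed) stream, and the answer given after receiving
   x_1, ..., x_t is [answer w [:: x_1; ...; x_t]], a function of the coins w and
   of the records received so far only.  Randomness drawn afresh at each step is
   covered by taking a product space for [coins].  [answer] is only ever used on
   histories of length 1, ..., T. *)
Record mechanism (R : realType) (d T : nat) := Mechanism {
  coins_display : measure_display;
  coins : measurableType coins_display;
  law : probability coins R;
  answer : coins -> seq (datum d) -> 'I_d;
  measurable_answer : forall (s : seq (datum d)) (a : 'I_d),
    measurable [set w | answer w s = a]
}.

Definition run (R : realType) (d T : nat) (M : mechanism R d T)
    (x : T.-tuple (datum d)) (w : coins M) : T.-tuple 'I_d :=
  [tuple answer w (take t.+1 x) | t < T].

Definition max_err (d T : nat) (x : T.-tuple (datum d)) (a : T.-tuple 'I_d)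
    : nat :=
  (\max_(t < T) err (take t.+1 x) (tnth a t))%N.

Definition accurate (R : realType) (d T : nat) (alpha : R)
    (M : mechanism R d T) : Prop :=
  forall x : T.-tuple (datum d),
    ((2 / 3)%:E <= law M [set w | ((max_err x (run x w))%:R <= alpha)%R])%E.

Definition neighbors (d T : nat) (x y : T.-tuple (datum d)) : Prop :=
  #|[set t : 'I_T | tnth x t != tnth y t]%SET| = 1%N.

Definition diff_private (R : realType) (d T : nat) (eps delta : R)
    (M : mechanism R d T) : Prop :=
  forall (x y : T.-tuple (datum d)), neighbors x y ->
  forall S : {set T.-tuple 'I_d},
    (law M [set w | run x w \in S] <=
       (expR eps)%:E * law M [set w | run y w \in S] + delta%:E)%E.

(* f = \tilde\Omega(g) means f = \Omega(g / log^p g) for some fixed p; the 2 in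
   the logarithm keeps it bounded away from 0 for all g >= 0. *)
Definition soft (R : realType) (p : nat) (g : R) : R := g / ln (2 + g) ^+ p.

Definition approx_rate (R : realType) (eps : R) (d T : nat) : R :=
  Num.min
    (Num.min
       (T%:R `^ (1 / 3) * ln d%:R `^ (2 / 3) / eps `^ (2 / 3))
       (Num.sqrt d%:R / eps))
    T%:R.

Definition pure_rate (R : realType) (eps : R) (d T : nat) : R :=
  Num.min
    (Num.min
       (Num.sqrt (T%:R / eps * ln (2 + d%:R / Num.sqrt (eps * T%:R))))
       (d%:R / eps))
    T%:R.

Definition pure_simple_rate (R : realType) (eps : R) (d T : nat) : R :=
  Num.min
    (Num.min (Num.sqrt (T%:R * ln d%:R / eps)) (d%:R / eps))
    T%:R.

(* Main.v *)
(* Every answer of an accurate mechanism is almost a maximal column, so one stream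
   can be made to answer k selection problems about the same N private records:
   split the columns into k blocks, and after the private records raise each block in
   turn by N public records, query it, and level it again by N records that are 1
   off the block. This costs T = N (1 + 2k) and changes no privacy parameter.

   Pure privacy: let each block have v columns and let all private records be equal,
   with a single 1 in each block. The v^k resulting streams are at distance at most
   N and have disjoint sets of accurate answers, so v^k * 2/3 <= e^(N eps).

   Approximate privacy: let each block have 2^m columns, indexed by m bits, and cut
   the records into m groups of n; a record of group l carries a secret bit per
   block, and column w shows whether it agrees with the bit w_l. A good column
   agrees with the majority of most groups. Draw the n secret bits of a group and
   block from a Polya urn, together with a spare bit, and let the score of a record
   be the sum over blocks of (answered sign) * (bit - spare bit). Bayes' rule makes
   the total score at least of order k m n, whereas privacy bounds each score by its
   value for an answer that does not see the record, where it is a sum of k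
   uncorrelated terms, hence by O(eps sqrt k + delta k). So k = O((n eps)^2).

   Both arguments are empty when the claimed bound is O(1); there alpha >= 1
   follows by packing streams that differ in one of 40 short phases. *)
Require Import Defs.
From HB Require Import structures.
From mathcomp Require Import all_boot all_order all_algebra perm.
From mathcomp Require Import all_classical all_reals all_analysis.
From mathcomp Require Import ring lra zify.

Set Implicit Arguments.
Unset Strict Implicit.
Unset Printing Implicit Defensive.

Import Order.TTheory GRing.Theory Num.Theory.
Import numFieldNormedType.Exports.

Local Open Scope classical_set_scope.
Local Open Scope ring_scope.

(** * Fingerprinting against a Polya urn *)

(** The factor [a] stands for [e^eps]; as a plain field element it keeps this part free of
    [expR]. *)
Definition indist (R : realFieldType) (O : finType) (a delta : R) (p q : O -> R) :=
  forall S : {set O}, \sum_(o in S) p o <= a * \sum_(o in S) q o + delta.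

(** The worst event is [S], where [p] is at least [a q]: off it the excess is negative, and on it
    [f] is at most [B]. *)
Lemma indist_expectation (R : realFieldType) (O : finType) (a delta B : R)
    (p q f : O -> R) :
  indist a delta p q -> 0 <= B -> (forall o, 0 <= f o <= B) ->
  \sum_o p o * f o <= a * \sum_o q o * f o + delta * B.
Proof.
move=> pq B0 fB; pose S := [set o | a * q o <= p o]%SET.
rewrite -lerBlDl mulr_sumr -sumrB.
apply: (@le_trans _ _ (\sum_(o in S) (p o - a * q o) * B)).
  rewrite [leRHS]big_mkcond /=; apply: ler_sum => o _.
  have /andP[f0 f1] := fB o; rewrite inE mulrA -mulrBl.
  case: (leP (a * q o)) => h; first by rewrite ler_wpM2l // subr_ge0.
  by rewrite mulr_le0_ge0 // subr_le0 ltW.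
rewrite -mulr_suml ler_wpM2r // sumrB lerBlDl -mulr_sumr.
exact: pq.
Qed.

Lemma sum_ord_cst (R : realFieldType) (n : nat) (x : R) :
  \sum_(i < n) x = n%:R * x.
Proof. by rewrite sumr_const card_ord mulr_natl. Qed.

Definition sgb (R : realFieldType) (b : bool) : R := if b then 1 else -1.

Lemma sgb_sqr (R : realFieldType) (b : bool) : sgb R b * sgb R b = 1.
Proof. by case: b; rewrite /sgb ?mulr1 // mulrNN mulr1. Qed.

Lemma sgb_norm (R : realFieldType) (b : bool) : `|sgb R b| = 1.
Proof. by case: b; rewrite /sgb ?normrN normr1. Qed.

(** * The Polya urn: exchangeability, conditional mean of the spare bit, second moment *)

Section Urn.
Variables (R : realFieldType) (n : nat) (C : finType).

(** [Some i] is the bit of record [i], and [None] is the spare bit. *)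
Let column := {ffun option 'I_n -> bool}.
Let config := {ffun C -> column}.
Implicit Types (x : column) (X : config) (c : C) (i j : 'I_n).

Definition ones x := (\sum_u x u)%N.

(* The law of a Polya urn started with one ball of each colour, up to the factor
   (n + 2)!: given a uniform p in [0, 1], n + 1 independent p-biased bits. *)
Definition urn x : R := ((ones x)`! * (n.+1 - ones x)`!)%:R.

Definition mass X : R := \prod_c urn (X c).

Definition mean (f : config -> R) : R :=
  (\sum_X mass X * f X) / \sum_X mass X.

Definition swap c i X : config :=
  [ffun c' => [ffun u => X c' (if c' == c then tperm None (Some i) u else u)]].

Definition flip c X : config :=
  [ffun c' => [ffun u => X c' u (+) ((c' == c) && (u == None))]].

Definition bit X c u : R := sgb R (X c u).

Definition total X c : R := \sum_i bit X c (Some i).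

Lemma urn_gt0 x : 0 < urn x.
Proof. by rewrite ltr0n muln_gt0 !fact_gt0. Qed.

Lemma mass_gt0 X : 0 < mass X.
Proof. by apply: prodr_gt0 => c _; exact: urn_gt0. Qed.

Lemma total_mass_gt0 : 0 < \sum_X mass X.
Proof.
rewrite (bigD1 [ffun=> [ffun=> false]]) //= ltr_pwDl ?mass_gt0 //.
by apply: sumr_ge0 => X _; exact/ltW/mass_gt0.
Qed.

Lemma mean_eq f g : f =1 g -> mean f = mean g.
Proof. by move=> fg; congr (_ / _); apply: eq_bigr => X _; rewrite fg. Qed.

Lemma meanD f g : mean (fun X => f X + g X) = mean f + mean g.
Proof.
by rewrite -mulrDl -big_split; congr (_ / _); apply: eq_bigr => X _; rewrite mulrDr.
Qed.

Lemma meanZ a f : mean (fun X => a * f X) = a * mean f.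
Proof.
by rewrite /mean mulrA mulr_sumr; congr (_ / _); apply: eq_bigr => X _; rewrite mulrCA.
Qed.

Lemma meanB f g : mean (fun X => f X - g X) = mean f - mean g.
Proof.
rewrite -mulN1r -meanZ -meanD; apply: mean_eq => X; by rewrite mulN1r.
Qed.

Lemma mean_cst a : mean (fun=> a) = a.
Proof. by rewrite /mean -mulr_suml mulrAC mulfV ?mul1r // gt_eqF // total_mass_gt0. Qed.

Lemma mean_sum (I : finType) (f : I -> config -> R) :
  mean (fun X => \sum_i f i X) = \sum_i mean (f i).
Proof.
rewrite -mulr_suml; congr (_ / _); rewrite exchange_big /=.
by apply: eq_bigr => X _; rewrite mulr_sumr.
Qed.

Lemma le_mean f g : (forall X, f X <= g X) -> mean f <= mean g.
Proof.
move=> fg; apply: ler_wpM2r; first by rewrite invr_ge0 ltW // total_mass_gt0.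
by apply: ler_sum => X _; rewrite ler_wpM2l // ltW // mass_gt0.
Qed.

Lemma swapK c i : involutive (swap c i).
Proof.
move=> X; apply/ffunP => c'; apply/ffunP => u; rewrite !ffunE.
by case: eqP => // _; rewrite tpermK.
Qed.

Lemma flipK c : involutive (flip c).
Proof.
by move=> X; apply/ffunP => c'; apply/ffunP => u; rewrite !ffunE addbK.
Qed.

(** The weight sees only the number of ones, so the spare bit is exchangeable with the bit of any
    record. *)
Lemma mass_swap c i X : mass (swap c i X) = mass X.
Proof.
apply: eq_bigr => c' _; rewrite /urn.
suff -> : ones (swap c i X c') = ones (X c') by [].
rewrite /ones; case: (eqVneq c' c) => [->|neq].
  rewrite [RHS](reindex_inj (@perm_inj _ (tperm None (Some i)))) /=.
  by apply: eq_bigr => u _; rewrite !ffunE eqxx.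
by apply: eq_bigr => u _; rewrite !ffunE (negPf neq).
Qed.

Lemma mean_swap c i f : mean (fun X => f (swap c i X)) = mean f.
Proof.
congr (_ / _); rewrite [RHS](reindex_inj (can_inj (swapK c i))) /=.
by apply: eq_bigr => X _; rewrite mass_swap.
Qed.

Lemma mean_odd c i f : (forall X, f (swap c i X) = - f X) -> mean f = 0.
Proof.
move=> odd_f; have := mean_swap c i f.
have -> : mean (fun X => f (swap c i X)) = - mean f.
  by rewrite -mulN1r -meanZ; apply: mean_eq => X; rewrite odd_f mulN1r.
by lra.
Qed.

Lemma bit_flip c X : bit (flip c X) c None = - bit X c None.
Proof. by rewrite /bit !ffunE !eqxx /=; case: (X c None); rewrite /sgb ?opprK. Qed.

Lemma bit_flip_row c X c' i : bit (flip c X) c' (Some i) = bit X c' (Some i).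
Proof. by rewrite /bit !ffunE andbF addbF. Qed.

Lemma total_flip c X c' : total (flip c X) c' = total X c'.
Proof. by apply: eq_bigr => i _; rewrite bit_flip_row. Qed.

Lemma big_option (A : Type) (idx : A) (op : Monoid.com_law idx)
    (F : option 'I_n -> A) :
  \big[op/idx]_u F u = op (F None) (\big[op/idx]_i F (Some i)).
Proof.
rewrite (bigD1 None) //=; congr (op _ _).
rewrite (reindex_omap Some id) /=; last by case.
by apply: eq_bigl => i; rewrite eqxx.
Qed.

Lemma totalE X c : total X c = 2 * (\sum_i X c (Some i))%:R - n%:R.
Proof.
rewrite natr_sum mulr_sumr -[in n%:R](card_ord n) -sum1_card natr_sum -sumrB.
by apply: eq_bigr => i _; rewrite /bit /sgb; case: (X c _); rewrite /=; lra.
Qed.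

(** Rule of succession: with [s] ones among the [n] records, the spare bits 1 and 0 have weights in
    ratio [s + 1] to [n - s + 1]. The conditional mean of the spare sign is thus
    [(2 s - n) / (n + 2)], which is [total / (n + 2)]. *)
Lemma urn_balance X c (g := fun X' => bit X' c None - total X' c / n.+2%:R) :
  urn (X c) * g X + urn (flip c X c) * g (flip c X) = 0.
Proof.
wlog h : X / X c None = true => [th|].
  case h : (X c None); first exact: th.
  have h' : flip c X c None = true by rewrite !ffunE h !eqxx.
  by have := th _ h'; rewrite flipK addrC.
rewrite /g bit_flip total_flip totalE /bit h /sgb.
set s := (\sum_i _)%N.
have sn : (s <= n)%N.
  rewrite -[leqRHS](card_ord n) -sum1_card /s; apply: leq_sum => i _.
  by case: (X c _).
have e1 : ones (X c) = s.+1 by rewrite /ones big_option h /= add1n.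
have e0 : ones (flip c X c) = s.
  rewrite /ones big_option !ffunE h !eqxx /= add0n.
  by apply: eq_bigr => i _; rewrite !ffunE /= addbF.
rewrite /urn e1 e0 subSS subSn // !factS !natrM.
have nz : n.+2%:R != 0 :> R by rewrite pnatr_eq0.
have -> : s.+1%:R = s%:R + 1 :> R by rewrite natr1.
have -> : (n - s).+1%:R = n%:R - s%:R + 1 :> R by rewrite -natr1 natrB.
have nE : n.+2%:R = n%:R + 2 :> R by rewrite -addn2 natrD.
move: nz; rewrite nE => nz.
by field.
Qed.

(** As [f] does not see the spare bit of [c], that bit may be replaced by its conditional mean. *)
Lemma mean_spare c f : (forall X, f (flip c X) = f X) ->
  mean (fun X => f X * bit X c None) = mean (fun X => f X * total X c) / n.+2%:R.
Proof.
move=> f_flip; apply/eqP; rewrite -subr_eq0 [_ / _]mulrC -meanZ -meanB; apply/eqP.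
pose g X := bit X c None - total X c / n.+2%:R.
rewrite (mean_eq (g := fun X => f X * g X)); last by move=> X; rewrite /g; ring.
rewrite /mean; set A := \sum_X _.
(* Reindexing one copy of [A] by [flip c] pairs the two values of the spare bit, and each pair
   cancels by [urn_balance]. *)
suff A0 : A + A = 0.
  have -> : A = 0 by lra.
  by rewrite mul0r.
rewrite {2}/A (reindex_inj (can_inj (flipK c))) -big_split /= big1 // => X _.
rewrite f_flip /mass (bigD1 c) //= [X in _ + X * _](bigD1 c) //=.
have -> : \prod_(c' | c' != c) urn (flip c X c') = \prod_(c' | c' != c) urn (X c').
  apply: eq_bigr => c' /negPf nc; congr urn.
  by apply/ffunP => u; rewrite !ffunE nc addbF.
have := urn_balance X c; rewrite -/(g X) -/(g (flip c X)) => bal.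
set P := \prod_(_ | _) _.
transitivity (P * f X * (urn (X c) * g X + urn (flip c X c) * g (flip c X))).
  by ring.
by rewrite bal mulr0.
Qed.

Lemma bit_sqr X c u : bit X c u * bit X c u = 1.
Proof. exact: sgb_sqr. Qed.

(** Two linear equations determine the second moment [q] and the correlation [w] of total and spare
    bit: [w (n + 2) = q] by [mean_spare], and [q = n + (n - 1) w] by exchanging record [j] with the
    spare bit in each off-diagonal product. *)
Lemma mean_total_sqr c : mean (fun X => total X c ^+ 2) = n%:R * n.+2%:R / 3.
Proof.
set q := mean _; set w := mean (fun X => total X c * bit X c None).
have wq : w * n.+2%:R = q.
  rewrite /w mean_spare; last by move=> X; rewrite total_flip.
  rewrite mulfVK ?pnatr_eq0 //; by apply: mean_eq => X; rewrite expr2.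
have pair i j : i != j ->
    mean (fun X => bit X c (Some i) * bit X c (Some j)) =
    mean (fun X => bit X c (Some i) * bit X c None).
  move=> ij; rewrite -(mean_swap c j); apply: mean_eq => X.
  by rewrite /bit !ffunE eqxx tpermR tpermD // (inj_eq (@Some_inj _)) eq_sym.
have qw : q = n%:R + (n%:R - 1) * w.
  have -> : q = \sum_i \sum_j mean (fun X => bit X c (Some i) * bit X c (Some j)).
    rewrite -[RHS](eq_bigr _ (fun i _ => mean_sum _)) -mean_sum.
    apply: mean_eq => X; rewrite expr2 mulr_suml; apply: eq_bigr => i _.
    by rewrite mulr_sumr.
  have -> : w = \sum_i mean (fun X => bit X c (Some i) * bit X c None).
    by rewrite -mean_sum; apply: mean_eq => X; rewrite mulr_suml.
  have e1 : \sum_(i < n) (1 : R) = n%:R by rewrite sum_ord_cst mulr1.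
  rewrite mulr_sumr -[X in _ = X + _]e1 -big_split /=.
  apply: eq_bigr => i _; rewrite (bigD1 i) //=; congr (_ + _).
    by rewrite -[RHS](mean_cst 1); apply: mean_eq => X; rewrite bit_sqr.
  rewrite (eq_bigr (fun=> mean (fun X => bit X c (Some i) * bit X c None)));
    last by move=> j ji; rewrite pair // eq_sym.
  rewrite sumr_const cardC1 card_ord -[LHS]mulr_natl; congr (_ * _).
  by rewrite -subn1 natrB // (leq_ltn_trans _ (ltn_ord i)).
move: wq qw; rewrite -addn2 natrD; nra.
Qed.

(** Since [|total| <= n], the absolute value is at least [total ^ 2 / n]. *)
Lemma mean_abs_total c : (0 < n)%N -> n.+2%:R / 3 <= mean (fun X => `|total X c|).
Proof.
move=> n0; have n0' : 0 < n%:R :> R by rewrite ltr0n.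
have -> : n.+2%:R / 3 = mean (fun X => n%:R^-1 * total X c ^+ 2).
  rewrite meanZ mean_total_sqr; field; exact: lt0r_neq0.
apply: le_mean => X; rewrite ler_pdivrMl // -real_normK ?num_real //.
rewrite expr2 ler_wpM2r // (le_trans (ler_norm_sum _ _ _)) //.
rewrite (eq_bigr (fun=> 1)) ?sumr_const ?card_ord //.
by move=> i _; exact: sgb_norm.
Qed.

End Urn.

(** * Expected scores: bounded above by privacy, below by accuracy *)

Section Fingerprint.
Variables (R : realFieldType) (k m n : nat) (O : finType).
Let cell := ('I_k * 'I_m)%type.
Let config := {ffun cell -> {ffun option 'I_n -> bool}}.

(** [Q D] is the output law on private bits [D], and [v o (b, l)] is the sign that [o] answers for
    group [l] in block [b]. *)
Variables (Q : {ffun cell -> {ffun 'I_n -> bool}} -> O -> R) (v : O -> cell -> bool).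
Variables (a eps delta : R).

Hypothesis Q_ge0 : forall D o, 0 <= Q D o.
Hypothesis Q_sum1 : forall D, \sum_o Q D o = 1.
Hypothesis Q_private : forall (l : 'I_m) (i : 'I_n) (D D' : {ffun cell -> {ffun 'I_n -> bool}}),
  (forall c j, (c.2 != l) || (j != i) -> D c j = D' c j) ->
  indist a delta (Q D) (Q D').
Hypothesis eps_ge0 : 0 <= eps.
Hypothesis eps_le1 : eps <= 1.
Hypothesis delta_ge0 : 0 <= delta.
Hypothesis a_le : a <= 1 + 3 * eps.
Hypothesis a_le_inv : (1 - eps) * a <= 1.

Definition rows (X : config) : {ffun cell -> {ffun 'I_n -> bool}} :=
  [ffun c => [ffun i => X c (Some i)]].

(** An answer drawn on the erased data cannot depend on record [i] of group [l]; this is the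
    comparison point for the score of that record. *)
Definition erase (l : 'I_m) (i : 'I_n) (D : {ffun cell -> {ffun 'I_n -> bool}}) :
    {ffun cell -> {ffun 'I_n -> bool}} :=
  [ffun c => [ffun j => D c j && ((c.2 != l) || (j != i))]].

Definition avg (q : config -> O -> R) (f : config -> O -> R) : R :=
  mean (fun X => \sum_o q X o * f X o).

Definition score l i (X : config) (o : O) : R :=
  \sum_b sgb R (v o (b, l)) * (bit R X (b, l) (Some i) - bit R X (b, l) None).

Let erased l i X := Q (erase l i (rows X)).

Lemma erase_swap l i b (X : config) :
  erase l i (rows (swap (b, l) i X)) = erase l i (rows X).
Proof.
apply/ffunP => c; apply/ffunP => j; rewrite !ffunE.
case: (eqVneq c (b, l)) => [->|nc]; last by [].
case: (eqVneq j i) => [->|ji]; first by rewrite eqxx !andbF.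
by rewrite tpermD // (inj_eq (@Some_inj _)) eq_sym.
Qed.

Lemma bit_diff_swap (c c' : cell) i (X : config) :
  bit R (swap c i X) c' (Some i) - bit R (swap c i X) c' None =
  (if c' == c then -1 else 1) * (bit R X c' (Some i) - bit R X c' None).
Proof.
rewrite /bit !ffunE; case: eqP => _; last by rewrite mul1r.
by rewrite tpermL tpermR mulN1r opprB.
Qed.

(** Swapping the erased bit with the spare bit of a block keeps the erased data and negates the
    summand of that block. *)
Lemma avg_erased_score l i : avg (erased l i) (score l i) = 0.
Proof.
rewrite /avg (mean_eq (g := fun X : config => \sum_b \sum_o erased l i X o *
    (sgb R (v o (b, l)) * (bit R X (b, l) (Some i) - bit R X (b, l) None)))).
  rewrite mean_sum big1 // => b _; apply: (mean_odd (c := (b, l)) (i := i)) => X.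
  rewrite -sumrN; apply: eq_bigr => o _.
  by rewrite /erased erase_swap bit_diff_swap eqxx; ring.
by move=> X; rewrite exchange_big; apply: eq_bigr => o _; rewrite mulr_sumr.
Qed.

(** The same swap in block [b] negates a cross term with [b' != b], so only the [k] diagonal terms
    survive, each at most 4. *)
Lemma avg_erased_score_sqr l i :
  avg (erased l i) (fun X o => score l i X o ^+ 2) <= 4 * k%:R.
Proof.
pose t b b' (X : config) := \sum_o erased l i X o *
  (sgb R (v o (b, l)) * (bit R X (b, l) (Some i) - bit R X (b, l) None) *
   (sgb R (v o (b', l)) * (bit R X (b', l) (Some i) - bit R X (b', l) None))).
rewrite /avg (mean_eq (g := fun X : config => \sum_b \sum_b' t b b' X)); last first.
  move=> X; rewrite /t; under [RHS]eq_bigr do rewrite exchange_big.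
  rewrite [RHS]exchange_big; apply: eq_bigr => o _; rewrite expr2 mulr_suml mulr_sumr.
  by apply: eq_bigr => b _; rewrite !mulr_sumr; apply: eq_bigr => b' _.
rewrite mean_sum [leRHS]mulrC -sum_ord_cst.
apply: ler_sum => b _; rewrite mean_sum (bigD1 b) //= [X in _ + X]big1 => [|b' b'b].
  rewrite addr0 -[leRHS](@mean_cst R n cell 4); apply: le_mean => X.
  rewrite [leRHS](_ : 4 = \sum_o erased l i X o * 4); last first.
    by rewrite -mulr_suml Q_sum1 mul1r.
  apply: ler_sum => o _; rewrite ler_wpM2l ?Q_ge0 // mulrACA sgb_sqr mul1r.
  by rewrite /bit; case: (X _ _); case: (X _ _); rewrite /sgb /=; lra.
apply: (mean_odd (c := (b, l)) (i := i)) => X; rewrite -sumrN; apply: eq_bigr => o _.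
by rewrite /erased erase_swap !bit_diff_swap eqxx xpair_eqE (negPf b'b) /=; ring.
Qed.

Lemma score_bound l i X o : `|score l i X o| <= 2 * k%:R.
Proof.
rewrite (le_trans (ler_norm_sum _ _ _)) // [leRHS]mulrC -sum_ord_cst.
apply: ler_sum => b _; rewrite normrM sgb_norm mul1r (le_trans (ler_normB _ _)) //.
by rewrite /bit !sgb_norm.
Qed.

(** Privacy is applied to the positive part from real to erased data and to the negative part in the
    reverse direction, where [(1 - eps) a <= 1] inverts the factor. Each direction costs
    [2 k delta]. *)
Lemma score_private l i X :
  \sum_o Q (rows X) o * score l i X o <=
  \sum_o erased l i X o * score l i X o +
  3 * eps * \sum_o erased l i X o * `|score l i X o| + 4 * delta * k%:R.
Proof.
set z := score l i X; pose zp o := Num.max (z o) 0; pose zn o := Num.max (- z o) 0.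
have same c j : (c.2 != l) || (j != i) -> rows X c j = erase l i (rows X) c j.
  by move=> h; rewrite !ffunE h andbT.
have zE o : z o = zp o - zn o.
  by rewrite /zp /zn; case: (leP (z o) 0); case: (leP (- z o) 0); lra.
have absE o : `|z o| = zp o + zn o.
  have [z0|z0] := leP 0 (z o).
    by rewrite ger0_norm // /zp /zn max_l // max_r ?oppr_le0 // addr0.
  by rewrite ltr0_norm // /zp /zn max_r ?(ltW z0) // max_l ?oppr_ge0 ?(ltW z0) // add0r.
have k0 : 0 <= k%:R :> R by rewrite ler0n.
have B0 : 0 <= 2 * k%:R :> R by rewrite mulr_ge0.
have zpB o : 0 <= zp o <= 2 * k%:R.
  rewrite le_max lexx orbT ge_max B0 andbT /=.
  exact: le_trans (ler_norm _) (score_bound _ _ _ _).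
have znB o : 0 <= zn o <= 2 * k%:R.
  rewrite le_max lexx orbT ge_max B0 andbT /=.
  by rewrite (le_trans (ler_norm _)) // normrN score_bound.
have Hp := indist_expectation (Q_private same) B0 zpB.
have Hn := indist_expectation (Q_private (fun c j h => esym (same c j h))) B0 znB.
rewrite -/(erased l i X) in Hp Hn.
under eq_bigr do rewrite zE mulrBr.
under [in leRHS]eq_bigr do rewrite zE mulrBr.
under [X in 3 * eps * X]eq_bigr do rewrite absE mulrDr.
rewrite !sumrB big_split /=.
move: Hp Hn.
set A := \sum_o Q _ _ * zp _; set B := \sum_o Q _ _ * zn _.
set A' := \sum_o erased _ _ _ _ * zp _; set B' := \sum_o erased _ _ _ _ * zn _.
have A'0 : 0 <= A' by apply: sumr_ge0 => o _; rewrite mulr_ge0 ?Q_ge0 //; case/andP: (zpB o).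
have B'0 : 0 <= B' by apply: sumr_ge0 => o _; rewrite mulr_ge0 ?Q_ge0 //; case/andP: (znB o).
have B''0 : 0 <= B by apply: sumr_ge0 => o _; rewrite mulr_ge0 ?Q_ge0 //; case/andP: (znB o).
move=> Hp Hn.
have h1 : a * A' <= (1 + 3 * eps) * A' by rewrite ler_wpM2r.
have h2 : (1 - eps) * B' <= (1 - eps) * (a * B + delta * (2 * k%:R)).
  by rewrite ler_wpM2l // subr_ge0.
have h3 : (1 - eps) * a * B <= B by rewrite -[leRHS]mul1r ler_wpM2r.
have h4 : 0 <= delta * k%:R by rewrite mulr_ge0.
have h5 : 0 <= eps * (delta * k%:R) by rewrite mulr_ge0.
have h6 : 0 <= eps * B' by rewrite mulr_ge0.
by lra.
Qed.

(** Instead of Cauchy-Schwarz, which would need a square root, [|z| <= z ^ 2 / (2 lam) + lam / 2] is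
    averaged; [lam] is left free to be optimised later. *)
Lemma avg_score_le l i (lam : R) : 0 < lam ->
  avg (Q \o rows) (score l i) <=
  3 * eps * (2 * k%:R / lam + lam / 2) + 4 * delta * k%:R.
Proof.
move=> lam0.
apply: le_trans (le_mean (score_private l i)) _.
rewrite !meanD meanZ mean_cst -/(avg _ _) avg_erased_score add0r lerD2r.
apply: ler_wpM2l; first by rewrite mulr_ge0.
apply: (@le_trans _ _ (mean (fun X : config => (2 * lam)^-1 *
    (\sum_o erased l i X o * score l i X o ^+ 2) + lam / 2))).
  apply: le_mean => X.
  rewrite [lam / 2](_ : _ = \sum_o erased l i X o * (lam / 2)); last first.
    by rewrite -mulr_suml Q_sum1 mul1r.
  rewrite mulr_sumr -big_split; apply: ler_sum => o _ /=.
  rewrite mulrCA -mulrDr ler_wpM2l ?Q_ge0 //.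
  set z := score _ _ _ _; rewrite -(ler_pM2l (x := 2 * lam)) ?mulr_gt0 //.
  rewrite mulrDr mulVKf ?mulf_neq0 ?lt0r_neq0 //.
  have := sqr_ge0 (`|z| - lam); have := real_normK (num_real z).
  by rewrite !expr2; lra.
rewrite meanD mean_cst lerD2r meanZ.
have -> : 2 * k%:R / lam = (2 * lam)^-1 * (4 * k%:R).
  by field; rewrite lt0r_neq0.
by rewrite ler_wpM2l ?avg_erased_score_sqr // invr_ge0 mulr_ge0 // ltW.
Qed.

Definition signed_total (X : config) (o : O) (c : cell) : R :=
  sgb R (v o c) * total R X c.

Lemma sum_cell (F : cell -> R) : \sum_c F c = \sum_b \sum_l F (b, l).
Proof. by rewrite pair_bigA; apply: eq_bigr => -[]. Qed.

Lemma rows_flip c (X : config) : rows (flip c X) = rows X.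
Proof.
by apply/ffunP => c'; apply/ffunP => i; rewrite !ffunE andbF addbF.
Qed.

(** Summing over the records of a group gives the total minus [n] spare bits. The answer does not
    see the spare bit, so the latter averages to [total / (n + 2)], and
    [1 - n / (n + 2) = 2 / (n + 2)] remains. *)
Lemma sum_avg_score l :
  \sum_i avg (Q \o rows) (score l i) =
  2 / n.+2%:R *
    avg (Q \o rows) (fun X o => \sum_b signed_total X o (b, l)).
Proof.
pose w b (X : config) := \sum_o Q (rows X) o * sgb R (v o (b, l)).
have -> : avg (Q \o rows) (fun X o => \sum_b signed_total X o (b, l)) =
    \sum_b mean (fun X : config => w b X * total R X (b, l)).
  rewrite -mean_sum; apply: mean_eq => X; under eq_bigr do rewrite mulr_sumr.
  rewrite exchange_big; apply: eq_bigr => b _; rewrite mulr_suml.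
  by apply: eq_bigr => o _; rewrite mulrA.
transitivity (mean (fun X : config => \sum_b
    (w b X * total R X (b, l) - n%:R * (w b X * bit R X (b, l) None)))); last first.
  rewrite mean_sum mulr_sumr; apply: eq_bigr => b _.
  rewrite meanB meanZ mean_spare; last by move=> X; rewrite /w rows_flip.
  set t := mean _; have -> : n.+2%:R = n%:R + 2 :> R by rewrite -addn2 natrD.
  by field; rewrite gt_eqF // ltr_wpDl.
rewrite -[LHS]mean_sum; apply: mean_eq => X; rewrite exchange_big /=.
under eq_bigr => o _ do rewrite -mulr_sumr exchange_big /= mulr_sumr.
rewrite exchange_big; apply: eq_bigr => b _; rewrite /w mulr_suml mulr_suml mulr_sumr -sumrB.
apply: eq_bigr => o _; rewrite -mulr_sumr sumrB sumr_const card_ord -mulr_natl.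
by rewrite /total; ring.
Qed.

Variable alpha : R.
Hypothesis n_gt0 : (0 < n)%N.
Hypothesis m_gt0 : (0 < m)%N.
Hypothesis k_gt0 : (0 < k)%N.

Definition spread (X : config) : R := \sum_c `|total R X c|.

(** A column sum is half of [m n] plus a signed total, hence an error [alpha] becomes
    [2 * alpha]. *)
Hypothesis Q_accurate : forall X : config,
  2 / 3 <= \sum_(o | [forall b, \sum_l `|total R X (b, l)| - 2 * alpha <=
                         \sum_l signed_total X o (b, l)]) Q (rows X) o.

(** With probability at least 2/3 the signed totals reach [spread - 2 alpha k]; otherwise they are
    still at least [- spread]. A third of the spread remains. *)
Lemma avg_signed_total_ge :
  0 <= alpha ->
  k%:R * (m%:R * n.+2%:R / 9 - 2 * alpha) <=
  avg (Q \o rows) (fun X o => \sum_c signed_total X o c).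
Proof.
move=> alpha0.
apply: (@le_trans _ _ (mean (fun X : config => 3^-1 * spread X - 2 * alpha * k%:R))).
  rewrite meanB mean_cst meanZ /spread mean_sum.
  have : \sum_(c : cell) n.+2%:R / 3 <=
      \sum_(c : cell) mean (fun X : config => `|total R X c|).
    by apply: ler_sum => c _; exact: mean_abs_total.
  by rewrite sumr_const card_prod !card_ord -[_ *+ (k * m)]mulr_natl natrM; lra.
apply: le_mean => X.
have := Q_accurate X; set g := \sum_(o | _) _ => g_ge.
have S0 : 0 <= spread X by apply: sumr_ge0.
have st_ge o c : - `|total R X c| <= signed_total X o c.
  by rewrite lerNl (le_trans (ler_norm _)) // normrN normrM sgb_norm mul1r.
have := Q_sum1 (rows X).
rewrite [\sum_o Q _ _ * _](bigID (fun o => [forall b, \sum_l `|total R X (b, l)| - 2 * alpha <=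
                         \sum_l signed_total X o (b, l)])) /=.
rewrite (bigID (fun o => [forall b, \sum_l `|total R X (b, l)| - 2 * alpha <=
                         \sum_l signed_total X o (b, l)])) /= -/g.
set g' := \sum_(o | ~~ _) _ => gg'.
have g'0 : 0 <= g' by apply: sumr_ge0.
apply: (@le_trans _ _ (g * (spread X - 2 * alpha * k%:R) + g' * - spread X)); last first.
  apply: lerD; rewrite mulr_suml; apply: ler_sum => o.
    move=> /forallP acc; rewrite ler_wpM2l // /spread.
    rewrite !sum_cell.
    rewrite [2 * alpha * _]mulrC -[k%:R * _]sum_ord_cst -sumrB.
    by apply: ler_sum => b _; exact: acc.
  by move=> _; rewrite ler_wpM2l // -sumrN; apply: ler_sum.
have ak0 : 0 <= alpha * k%:R by rewrite mulr_ge0.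
have h1 : 0 <= (g - 2 / 3) * spread X by rewrite mulr_ge0 // subr_ge0.
have g'E : g' = 1 - g by lra.
have h2 : 0 <= (1 - g) * (alpha * k%:R) by rewrite -g'E mulr_ge0.
rewrite g'E; lra.
Qed.

Lemma fingerprint :
  0 <= alpha -> 36 * alpha <= (m * n)%:R -> 72 * (n%:R * delta) <= 1 -> 0 < eps ->
  k%:R <= (108 * (n%:R * eps)) ^+ 2.
Proof.
move=> alpha0; rewrite natrM => alpha_le ndelta eps0.
have n0 : 0 < n%:R :> R by rewrite ltr0n.
have m0 : 0 < m%:R :> R by rewrite ltr0n.
have k0 : 0 < k%:R :> R by rewrite ltr0n.
set ne := n%:R * eps; have ne0 : 0 < ne by rewrite mulr_gt0.
(* This makes the term [3 ne lam / 2] equal to [k / 36]. With the [delta] term, at most [k / 18], it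
   leaves [k / 36] out of [k / 9] to be paid by [324 ne ^ 2]. *)
pose lam := k%:R / (54 * ne).
have lam0 : 0 < lam by rewrite divr_gt0 // mulr_gt0.
set B := 3 * eps * (2 * k%:R / lam + lam / 2) + 4 * delta * k%:R.
have nB : n%:R * B = 324 * ne ^+ 2 + k%:R / 36 + 4 * (n%:R * delta) * k%:R.
  by rewrite /B /lam /ne; field; rewrite !lt0r_neq0.
have := avg_signed_total_ge alpha0; set G := avg _ _ => G_ge.
have GE : 2 / n.+2%:R * G = \sum_l \sum_i avg (Q \o rows) (score l i).
  rewrite (eq_bigr _ (fun l _ => sum_avg_score l)) -mulr_sumr; congr (_ * _).
  rewrite -mean_sum; apply: mean_eq => X; rewrite exchange_big; apply: eq_bigr => o _.
  rewrite -mulr_sumr; congr (_ * _).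
  by rewrite sum_cell exchange_big.
have G_le : 2 / n.+2%:R * G <= m%:R * (n%:R * B).
  rewrite GE -sum_ord_cst; apply: ler_sum => l _.
  rewrite -sum_ord_cst; apply: ler_sum => i _.
  exact: avg_score_le.
have N0 : 0 < n.+2%:R :> R by rewrite ltr0n.
have nN : n%:R < n.+2%:R :> R by rewrite ltr_nat.
(* The condition [36 alpha <= m n] lets the error cost at most half of the main term. *)
have G_ge' : m%:R * k%:R / 9 <= 2 / n.+2%:R * G.
  rewrite [leRHS]mulrAC ler_pdivlMr //.
  have : k%:R * (36 * alpha) <= k%:R * (m%:R * n.+2%:R).
    by rewrite (ler_wpM2l (ltW k0)) // (le_trans alpha_le) // (ler_wpM2l (ltW m0)) // ltW.
  by move: G_ge; lra.
have : m%:R * (k%:R / 9) <= m%:R * (n%:R * B).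
  by rewrite mulrA; exact: le_trans G_le.
rewrite ler_pM2l // nB.
have : k%:R * (72 * (n%:R * delta)) <= k%:R * 1 by rewrite ler_wpM2l // ltW.
by rewrite -/ne; lra.
Qed.

End Fingerprint.

(** * Laws of the output stream *)

Definition pmf (R : realType) (d T : nat) (M : mechanism R d T)
    (x : T.-tuple (datum d)) (y : T.-tuple 'I_d) : R :=
  fine (law M [set w | run x w = y]).

Definition hamming (d T : nat) (x y : T.-tuple (datum d)) : nat :=
  #|[set t : 'I_T | tnth x t != tnth y t]%SET|.

Lemma hamming_eq0 (d T : nat) (x y : T.-tuple (datum d)) : hamming x y = 0%N -> x = y.
Proof.
move=> /cards0_eq xy; apply: eq_from_tnth => t; apply/eqP/negPn/negP => neq.
by have := finset.in_set0 t; rewrite -xy inE neq.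
Qed.

Section Law.
Variables (R : realType) (d T : nat) (M : mechanism R d T).
Implicit Types (x : T.-tuple (datum d)) (y : T.-tuple 'I_d).

Lemma measurable_run x y : measurable [set w : coins M | run x w = y].
Proof.
have -> : [set w : coins M | run x w = y] =
    \bigcap_(t in [set: 'I_T]) [set w | answer w (take t.+1 x) = tnth y t].
  apply/seteqP; split => w /=.
    by move=> <- t _ /=; rewrite tnth_mktuple.
  by move=> h; apply: eq_from_tnth => t; rewrite tnth_mktuple; exact: h.
apply: fin_bigcap_measurable; first exact: finite_finset.
by move=> t _; exact: measurable_answer.
Qed.

Lemma pmf_law x y : law M [set w | run x w = y] = (pmf M x y)%:E.
Proof. by rewrite /pmf fineK // fin_num_measure //; exact: measurable_run. Qed.

Lemma pmf_ge0 x y : 0 <= pmf M x y.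
Proof. by rewrite -lee_fin -pmf_law. Qed.

Lemma law_run x (S : pred (T.-tuple 'I_d)) :
  law M [set w | S (run x w)] = (\sum_(y | S y) pmf M x y)%:E.
Proof.
rewrite -big_filter; set r := seq.filter _ _.
have -> : [set w : coins M | S (run x w)] = [set w | run x w \in r].
  by apply/seteqP; split => w /=; rewrite mem_filter mem_index_enum andbT.
(* Measurability is carried through the induction, since additivity on the tail requires it. *)
suff [] : measurable [set w : coins M | run x w \in r] /\
    law M [set w | run x w \in r] = (\sum_(y <- r) pmf M x y)%:E by [].
have : uniq r by rewrite filter_uniq // index_enum_uniq.
elim: r => [_|y r IH /= /andP[yr /IH [mr lr]]].
  rewrite big_nil; have -> : [set w : coins M | run x w \in [::]] = set0.
    by apply/seteqP; split => w.
  by rewrite measure0.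
have -> : [set w : coins M | run x w \in y :: r] =
    [set w | run x w = y] `|` [set w | run x w \in r].
  apply/seteqP; split => w /=; rewrite inE.
    by case/orP => [/eqP|]; [left|right].
  by case=> [->|->]; rewrite ?eqxx ?orbT.
have my := measurable_run x y.
split; first exact: measurableU.
rewrite big_cons EFinD -pmf_law -lr measureU //.
by apply/seteqP; split => w //= -[wy]; rewrite wy (negPf yr).
Qed.

Lemma pmf_sum1 x : \sum_y pmf M x y = 1.
Proof.
apply: EFin_inj; rewrite -(law_run x predT) -(@probability_setT _ _ _ (law M)).
by congr (law M _); apply/seteqP; split.
Qed.

Lemma accurate_pmf alpha x : accurate alpha M ->
  2 / 3 <= \sum_(y | (max_err x y)%:R <= alpha) pmf M x y.
Proof. by move=> /(_ x); rewrite (law_run x (fun y => (max_err x y)%:R <= alpha)) lee_fin. Qed.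

Variables eps delta : R.
Hypothesis eps_ge0 : 0 <= eps.
Hypothesis delta_ge0 : 0 <= delta.
Hypothesis M_private : diff_private eps delta M.

Lemma pmf_private x x' : (hamming x x' <= 1)%N ->
  indist (expR eps) delta (pmf M x) (pmf M x').
Proof.
rewrite leq_eqVlt ltnS leqn0 => /orP[/eqP xx'|/eqP/hamming_eq0 ->] S.
  have := M_private xx' S.
  by rewrite (law_run x (mem S)) (law_run x' (mem S)) -EFinM -EFinD lee_fin.
rewrite ler_wpDr // ler_peMl ?sumr_ge0 // => [y _|]; first exact: pmf_ge0.
by rewrite -expR0 ler_expR.
Qed.

Lemma pmf_group_private h x x' (S : {set T.-tuple 'I_d}) : (hamming x x' <= h)%N ->
  \sum_(y in S) pmf M x y <=
  expR (h%:R * eps) * (\sum_(y in S) pmf M x' y + h%:R * delta).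
Proof.
elim: h x => [|h IH] x.
  rewrite leqn0 mul0r expR0 mul0r addr0 mul1r => /eqP/hamming_eq0 ->.
  exact: lexx.
have [xx' _|[t]] := set_0Vmem [set t : 'I_T | tnth x t != tnth x' t]%SET.
  apply: le_trans (IH x _) _; first by rewrite /hamming xx' cards0.
  rewrite ler_pM ?expR_ge0 //.
  - by rewrite addr_ge0 ?mulr_ge0 ?sumr_ge0 // => y _; exact: pmf_ge0.
  - by rewrite ler_expR ler_wpM2r // ler_nat.
  by rewrite lerD2l ler_wpM2r // ler_nat.
rewrite inE => xt hx.
(* [z] corrects [x] at the single time [t], one step closer to [x']. *)
pose z := [tuple if s == t then tnth x' s else tnth x s | s < T].
have hz : (hamming z x' <= h)%N.
  rewrite -ltnS (leq_trans _ hx) // /hamming (cardsD1 t [set s | tnth x s != _]%SET).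
  rewrite inE xt add1n ltnS subset_leq_card //; apply/fintype.subsetP => s.
  by rewrite !inE tnth_mktuple; case: (eqVneq s t) => [->|]; rewrite ?eqxx.
have xz : (hamming x z <= 1)%N.
  rewrite /hamming -(cards1 t) subset_leq_card //; apply/fintype.subsetP => s.
  by rewrite !inE tnth_mktuple; case: (eqVneq s t) => // _; rewrite eqxx.
apply: le_trans (pmf_private xz S) _.
have := IH z hz; rewrite -(ler_pM2l (expR_gt0 eps)).
set A := \sum_(y in S) _; set B := \sum_(y in S) _ => h1.
have e1 : expR (h.+1%:R * eps) = expR eps * expR (h%:R * eps).
  by rewrite -expRD -natr1 mulrDl mul1r addrC.
rewrite e1 -natr1 mulrDl mul1r addrA mulrDr -mulrA; apply: lerD => //.
rewrite -e1 ler_peMl // -expR0 ler_expR mulr_ge0 //.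
Qed.

(** Group privacy moves the mass 2/3 of each accurate set to the common law at [x0], where disjoint
    sets have total mass at most 1. *)
Lemma packing (I : finType) (h : nat) (alpha : R) (x : I -> T.-tuple (datum d)) x0 :
  accurate alpha M ->
  (forall i, (hamming (x i) x0 <= h)%N) ->
  (forall i j y, (max_err (x i) y)%:R <= alpha -> (max_err (x j) y)%:R <= alpha ->
     i = j) ->
  #|I|%:R * (2 / 3) <= expR (h%:R * eps) * (1 + #|I|%:R * (h%:R * delta)).
Proof.
move=> acc hx disj; set e := expR _.
pose good i := [set y | (max_err (x i) y)%:R <= alpha]%SET.
have step i : 2 / 3 <= e * (\sum_(y in good i) pmf M x0 y + h%:R * delta).
  apply: le_trans (accurate_pmf (x i) acc) _.
  rewrite (eq_bigl (mem (good i))) => [|y]; last by rewrite !inE.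
  exact: pmf_group_private.
have card_cst (c : R) : \sum_(i : I) c = #|I|%:R * c by rewrite sumr_const mulr_natl.
rewrite -!card_cst; apply: (le_trans (ler_sum _ (fun i _ => step i))).
rewrite -mulr_sumr ler_wpM2l ?expR_ge0 // big_split /=.
rewrite lerD2r // -(pmf_sum1 x0).
rewrite (eq_bigr _ (fun i _ => big_mkcond _ _)) exchange_big /=.
apply: ler_sum => y _; rewrite -big_mkcond /=.
have [none|[i iy]] := set_0Vmem [set i | y \in good i]%SET.
  rewrite big1 ?pmf_ge0 // => i yi.
  by have := finset.in_set0 i; rewrite -none inE yi.
rewrite (bigD1 i) /= ?big1 ?addr0 //; last by move: iy; rewrite inE.
move=> j /andP[yj /negP[]]; apply/eqP.
by move: iy yj; rewrite !inE => iy yj; apply: (disj _ _ y).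
Qed.

End Law.

(** * Streams *)

Definition stream (d T : nat) (f : nat -> datum d) : T.-tuple (datum d) :=
  [tuple f t | t < T].

Lemma coord_sum_stream (d T : nat) (f : nat -> datum d) s j : (s <= T)%N ->
  coord_sum (take s (stream T f)) j = (\sum_(0 <= t < s) f t j)%N.
Proof.
move=> sT; have -> : tval (stream T f) = map f (iota 0 T).
  by rewrite /= -val_enum_ord -map_comp.
by rewrite /coord_sum -map_take take_iota (minn_idPl sT) big_map /index_iota subn0.
Qed.

Lemma coord_sum_le_err (d T : nat) (x : T.-tuple (datum d)) y (t : 'I_T) j :
  (coord_sum (take t.+1 x) j <= coord_sum (take t.+1 x) (tnth y t) + max_err x y)%N.
Proof.
have h1 : (err (take t.+1 x) (tnth y t) <= max_err x y)%N.
  exact: (leq_bigmax_cond (F := fun t : 'I_T => err (take t.+1 x) (tnth y t))).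
rewrite -leq_subLR; apply: leq_trans h1; apply: leq_sub2r.
exact: (leq_bigmax_cond (F := coord_sum (take t.+1 x))).
Qed.

(** * Streams that differ in one short phase, and the bound [1 <= alpha] *)

Section Phases.
Variables (d : nat) (j0 j1 : 'I_d).

(* In each of 40 phases the leader gains one record and the other of j0, j1
   catches up; only in phase l is the leader j1. *)
Definition phases (l t : nat) : datum d :=
  [ffun j => (t < 80)%N && (j == if odd t (+) (t./2 == l) then j1 else j0)].

Lemma sum_phases l p j : (p <= 40)%N ->
  (\sum_(0 <= t < p.*2) phases l t j = p * ((j == j0) + (j == j1)))%N.
Proof.
elim: p => [|p IH] p40; first by rewrite big_geq.
rewrite doubleS !big_nat_recr //= IH; last exact: ltnW.
rewrite !ffunE /= odd_double uphalf_double doubleK.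
have -> : (p.*2 < 80)%N by lia.
have -> : (p.*2.+1 < 80)%N by lia.
by case: (p == l) => /=; lia.
Qed.

Lemma sum_phases_lead l p j : (p < 40)%N ->
  (\sum_(0 <= t < p.*2.+1) phases l t j =
   p * ((j == j0) + (j == j1)) + (j == if p == l then j1 else j0))%N.
Proof.
move=> p40; rewrite big_nat_recr //= sum_phases; last exact: ltnW.
rewrite !ffunE /= odd_double doubleK.
by have -> : (p.*2 < 80)%N by lia.
Qed.

(** The centre [phases 40] has its exceptional phase after time 80, so [j0] leads in all its
    phases. *)
Lemma hamming_phases T (l : 'I_40) : (80 <= T)%N ->
  (hamming (stream T (phases l)) (stream T (phases 40)) <= 2)%N.
Proof.
move=> T80; have lT : (l.*2 < T)%N by have := ltn_ord l; lia.
have lT' : (l.*2.+1 < T)%N by have := ltn_ord l; lia.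
rewrite /hamming (@leq_trans #|[set Ordinal lT; Ordinal lT']%SET|) //; last first.
  by rewrite cards2; case: (_ == _).
apply/subset_leq_card/fintype.subsetP => t; rewrite !inE !tnth_mktuple -!val_eqE /=.
apply: contraR => h; apply/eqP/ffunP => j; rewrite !ffunE.
case: (ltnP t 80) => //= t80.
have -> : (t./2 == l) = false by lia.
by have -> : (t./2 == 40) = false by lia.
Qed.

(** After [2 l + 1] records [j1] is ahead by one in stream [l] and [j0] in stream [l']; no single
    answer is exact for both. *)
Lemma phases_disjoint T (l l' : 'I_40) y : (80 <= T)%N -> j0 != j1 ->
  max_err (stream T (phases l)) y = 0%N -> max_err (stream T (phases l')) y = 0%N ->
  l = l'.
Proof.
move=> T80 j01 yl yl'; apply/eqP/negPn/negP => ll'.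
have lT : (l.*2 < T)%N by have := ltn_ord l; lia.
have := coord_sum_le_err (stream T (phases l)) y (Ordinal lT) j1.
have := coord_sum_le_err (stream T (phases l')) y (Ordinal lT) j0.
rewrite yl yl' !addn0 !coord_sum_stream //= !sum_phases_lead // !eqxx.
have -> : (l == l' :> nat) = false by exact: negPf.
rewrite (negPf j01) [j1 == j0]eq_sym (negPf j01) eqxx.
set a := tnth y _; case: (eqVneq a j0) => [->|_]; first by rewrite (negPf j01); lia.
by case: (a == j1); lia.
Qed.

End Phases.

Lemma expR1_le4 (R : realType) : expR 1 <= 4 :> R.
Proof.
have h : 2^-1 <= expR (- 2^-1) :> R by have := expR_ge1Dx (- 2^-1 : R); lra.
have e : expR 1 * (expR (- 2^-1) * expR (- 2^-1)) = 1 :> R.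
  rewrite -!expRD (_ : 1 + _ = 0) ?expR0 //; lra.
have yy : 4^-1 <= expR (- 2^-1) * expR (- 2^-1) :> R.
  by rewrite (_ : 4^-1 = 2^-1 * 2^-1) ?ler_pM //; lra.
have : expR 1 * 4^-1 <= expR 1 * (expR (- 2^-1) * expR (- 2^-1)) :> R.
  by rewrite ler_wpM2l ?expR_ge0.
by rewrite e; lra.
Qed.

Lemma accuracy_ge1 (R : realType) (d T : nat) (M : mechanism R d T) (eps delta alpha : R) :
  0 <= eps -> eps <= 1 -> 0 <= delta -> delta <= 1 / 1000 -> (1 < d)%N -> (80 <= T)%N ->
  diff_private eps delta M -> accurate alpha M -> 1 <= alpha.
Proof.
move=> eps0 eps1 delta0 delta1 d1 T80 priv acc; rewrite leNgt; apply/negP => alpha1.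
have d0 : (0 < d)%N by exact: ltnW.
pose j0 := Ordinal d0; pose j1 := Ordinal d1.
have h0 (e : nat) : e%:R <= alpha -> e = 0%N.
  by move=> h; have := le_lt_trans h alpha1; rewrite -[1]/(1%:R) ltr_nat; case: e {h}.
have := @packing R d T M eps delta eps0 delta0 priv 'I_40 2 alpha
  (fun l => stream T (phases j0 j1 l)) (stream T (phases j0 j1 40)) acc
  (fun l => hamming_phases j0 j1 l T80)
  (fun l l' y yl yl' => phases_disjoint T80 (isT : j0 != j1) (h0 _ yl) (h0 _ yl')).
(* Packing would give [40 * 2/3 <= e ^ (2 eps) * (1 + 80 delta)], but the right side is at most
   [16 * 1.08]. *)
apply/negP; rewrite -ltNge card_ord.
have e2 : expR (2 * eps) <= 16.
  apply: (@le_trans _ _ (expR (1 + 1))); first by rewrite ler_expR; lra.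
  by rewrite expRD; have := expR1_le4 R; have := expR_ge0 (1 : R); nra.
by have := expR_ge0 (2 * eps); nra.
Qed.

(** * One stream that poses [k] selection problems about the same private records *)

Section Lift.
Variables (d T k : nat) (V I : finType) (phi : 'I_k * V -> 'I_d).
Hypothesis phi_inj : injective phi.
Local Notation N := #|I|.
Hypothesis T_ge : (N + k * (N + N) <= T)%N.

Definition in_block (b : nat) (j : 'I_d) : bool :=
  [exists c, (phi c == j) && (c.1 == b :> nat)].

(** Columns outside the image of [phi] hold 0 in every private record and lie in no block. *)
Definition encode (D : I -> 'I_k * V -> bool) (i : I) (j : 'I_d) : bool :=
  [exists c, (phi c == j) && D i c].

(* After the N private records, each block b < k gets N public records that are 1
   exactly on b, then N that are 1 exactly off b, so that all columns are level
   again. *)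
Definition lift (D : I -> 'I_k * V -> bool) (t : nat) : datum d :=
  [ffun j => if insub t is Some i then encode D (enum_val (i : 'I_N)) j
             else (((t - N) %/ (N + N) < k) &&
                   (((t - N) %% (N + N) < N) == in_block ((t - N) %/ (N + N)) j))%N].

Definition column_sum (D : I -> 'I_k * V -> bool) (c : 'I_k * V) : nat :=
  (\sum_i D i c)%N.

Lemma encode_phi D i c : encode D i (phi c) = D i c.
Proof.
apply/existsP/idP => [[c' /andP[/eqP /phi_inj ->]] //|Dic].
by exists c; rewrite eqxx.
Qed.

Lemma in_block_phi b c : in_block b (phi c) = (c.1 == b :> nat).
Proof.
apply/existsP/idP => [[c' /andP[/eqP /phi_inj ->]] //|h].
by exists c; rewrite eqxx.
Qed.

Lemma sum_lift_private D j :
  (\sum_(0 <= t < N) lift D t j = \sum_i encode D i j)%N.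
Proof.
rewrite big_mkord (reindex (@enum_val I predT)) /=; last first.
  by apply: onW_bij; exact: enum_val_bij.
by apply: eq_bigr => t _; rewrite ffunE valK.
Qed.

Lemma lift_public D b u j : (u < N + N)%N ->
  lift D (N + b * (N + N) + u) j = ((b < k)%N && ((u < N)%N == in_block b j)).
Proof.
move=> uN; rewrite ffunE insubF; last by lia.
have -> : (N + b * (N + N) + u - N = b * (N + N) + u)%N by lia.
have NN : (0 < N + N)%N by exact: leq_ltn_trans uN.
by rewrite divnMDl // modnMDl divn_small // modn_small // addn0.
Qed.

Lemma sum_lift_up D b j : (b < k)%N ->
  (\sum_(N + b * (N + N) <= t < N + b * (N + N) + N) lift D t j =
   N * in_block b j)%N.
Proof.
move=> bk; rewrite -{1}[(N + b * (N + N))%N]add0n big_addn addKn.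
rewrite (eq_big_nat _ _ (F2 := fun=> in_block b j : nat)) => [|u uN].
  by rewrite sum_nat_const_nat subn0.
rewrite addnC lift_public ?bk; last by lia.
by rewrite (_ : (u < N)%N = true) //; lia.
Qed.

Lemma sum_lift_down D b j : (b < k)%N ->
  (\sum_(N + b * (N + N) + N <= t < N + b.+1 * (N + N)) lift D t j =
   N * ~~ in_block b j)%N.
Proof.
move=> bk; rewrite -{1}[(N + b * (N + N) + N)%N]add0n big_addn.
rewrite (_ : (N + b.+1 * (N + N) - (N + b * (N + N) + N) = N)%N); last by rewrite mulSn; lia.
rewrite (eq_big_nat _ _ (F2 := fun=> ~~ in_block b j : nat)) => [|u uN].
  by rewrite sum_nat_const_nat subn0.
rewrite (_ : (u + (N + b * (N + N) + N) = N + b * (N + N) + (N + u))%N); last by lia.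
rewrite lift_public ?bk; last by lia.
by rewrite (_ : (N + u < N)%N = false) //; lia.
Qed.

Lemma sum_lift_level D b j : (b <= k)%N ->
  (\sum_(0 <= t < N + b * (N + N)) lift D t j = \sum_i encode D i j + b * N)%N.
Proof.
elim: b => [|b IH] bk; first by rewrite mul0n !addn0 sum_lift_private.
rewrite (@big_cat_nat _ _ _ (N + b * (N + N) + N)) //=; last by rewrite mulSn; lia.
rewrite sum_lift_down // (@big_cat_nat _ _ _ (N + b * (N + N))) //= ?leq_addr //.
rewrite sum_lift_up // IH; last exact: ltnW.
by case: (in_block b j); rewrite /= ?muln1 ?muln0 mulSn; lia.
Qed.

Lemma sum_lift_query D b j : (b < k)%N ->
  (\sum_(0 <= t < N + b * (N + N) + N) lift D t j =
   \sum_i encode D i j + b * N + N * in_block b j)%N.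
Proof.
move=> bk; rewrite (@big_cat_nat _ _ _ (N + b * (N + N))) //= ?leq_addr //.
by rewrite sum_lift_up // sum_lift_level // ltnW.
Qed.

(** Answers are indexed from 0, so the predecessor selects the answer given when block [b] has just
    been raised. The default [v0] is returned if that answer lies outside the block. *)
Definition decode (v0 : V) (y : T.-tuple 'I_d) (b : 'I_k) : V :=
  odflt v0
    [pick v | phi (b, v) == nth (phi (b, v0)) y (N + b * (N + N) + N).-1].

(** A column off the raised block has private sum at most [N], whereas a raised column gains [N] on
    top of its private sum. If some private sum in the block exceeds the error, the answer must lie
    in the block, where the public counts cancel. *)
Lemma decode_sound D (v0 : V) y b :
  (0 < N)%N ->
  (exists v, max_err (stream T (lift D)) y < column_sum D (b, v))%N ->
  forall v, (column_sum D (b, v) <=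
             column_sum D (b, decode v0 y b) + max_err (stream T (lift D)) y)%N.
Proof.
move=> N0; set e := max_err _ _ => -[v1 ev1] v.
have bk := ltn_ord b.
have qT : (N + b * (N + N) + N <= T)%N.
  have : (b.+1 * (N + N) <= k * (N + N))%N by rewrite leq_mul2r bk orbT.
  by rewrite mulSn; lia.
have qT' : ((N + b * (N + N) + N).-1 < T)%N by rewrite prednK //; lia.
have query v' := coord_sum_le_err (stream T (lift D)) y (Ordinal qT') (phi (b, v')).
rewrite /= prednK ?addn_gt0 ?N0 ?orbT // in query.
rewrite /decode; have {query} := query; rewrite (tnth_nth (phi (b, v0))) /=.
set a := nth _ _ _ => query.
have {}query v' : (column_sum D (b, v') + N <=
    \sum_i encode D i a + N * in_block b a + e)%N.
  have := query v'; rewrite !coord_sum_stream // !sum_lift_query // in_block_phi eqxx.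
  by rewrite (eq_bigr (fun i => D i (b, v') : nat)) => [|i _];
    rewrite ?encode_phi // /column_sum; lia.
case: pickP => [v' /eqP av'|none] /=.
  have := query v; rewrite -av' in_block_phi eqxx muln1.
  rewrite [X in (_ <= X + _ + _)%N -> _](_ : _ = column_sum D (b, v')); first by lia.
  by apply: eq_bigr => i _; rewrite encode_phi.
have := query v1.
have -> : in_block b a = false.
  apply/existsP => -[[b' v'] /andP[/eqP h /= /eqP /val_inj bb']].
  by have := none v'; rewrite -bb' h eqxx.
have : (\sum_i encode D i a <= N)%N.
  by rewrite -[leqRHS]sum1_card; apply: leq_sum => i _; case: encode.
by lia.
Qed.

Lemma hamming_lift D D' (A : {set I}) :
  (forall i, i \notin A -> D i = D' i) ->
  (hamming (stream T (lift D)) (stream T (lift D')) <= #|A|)%N.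
Proof.
move=> DD'; have NT : (N <= T)%N by apply: leq_trans T_ge; rewrite leq_addr.
pose f (i : I) : 'I_T := widen_ord NT (enum_rank i).
apply: leq_trans (leq_imset_card f A); apply/subset_leq_card/fintype.subsetP => t.
rewrite inE !tnth_mktuple; apply: contraR => tA; apply/eqP/ffunP => j; rewrite !ffunE.
case: insubP => [u _ ut|//].
suff /DD' uD : enum_val u \notin A by rewrite /encode uD.
apply: contra tA => uA; apply/imsetP; exists (enum_val u) => //.
by apply: val_inj; rewrite /= enum_valK.
Qed.

End Lift.

Lemma expR_le1D3x (R : realType) (x : R) : 0 <= x -> x <= 1 -> expR x <= 1 + 3 * x.
Proof.
move=> x0 x1; set y := expR (- (x / 2)).
have hy : 1 - x / 2 <= y by have := expR_ge1Dx (- (x / 2)); rewrite -/y; lra.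
have e : expR x * (y * y) = 1.
  by rewrite -!expRD (_ : x + _ = 0) ?expR0 //; lra.
have hyy : (1 - x / 2) * (1 - x / 2) <= y * y by apply: ler_pM => //; lra.
have p : 1 <= (1 + 3 * x) * ((1 - x / 2) * (1 - x / 2)).
  have : 0 <= x * ((1 - x) * (8 - 3 * x)) by rewrite !mulr_ge0 //; lra.
  by lra.
have yy0 : 0 < y * y by rewrite mulr_gt0 ?expR_gt0.
rewrite -(ler_pM2r yy0) e (le_trans p) // ler_wpM2l //; lra.
Qed.

Lemma ex_injection (k d : nat) (V : finType) : (k * #|V| <= d)%N ->
  exists phi : 'I_k * V -> 'I_d, injective phi.
Proof.
rewrite -{1}(card_ord k) -card_prod => kd; exists (widen_ord kd \o enum_rank) => c c'.
by move=> /(congr1 val) /= /val_inj /enum_rank_inj.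
Qed.

(** * Constraints on the block parameters of an accurate private mechanism *)

Section Bounds.
Variables (R : realType) (d T : nat) (M : mechanism R d T) (eps delta alpha : R).
Hypothesis eps_ge0 : 0 <= eps.
Hypothesis eps_le1 : eps <= 1.
Hypothesis delta_ge0 : 0 <= delta.
Hypothesis M_private : diff_private eps delta M.
Hypothesis M_accurate : accurate alpha M.

Lemma packing_bound (k v N : nat) :
  delta = 0 -> (0 < N)%N -> (k * v <= d)%N -> (N + k * (N + N) <= T)%N -> alpha < N%:R ->
  v%:R ^+ k * (2 / 3) <= expR (N%:R * eps).
Proof.
move=> delta0; case: v => [|v].
  case: k => [|k] *; last first.
    by rewrite expr0n mul0r expR_ge0.
  rewrite expr0 mul1r (@le_trans _ _ 1) //; first lra.
  by rewrite -expR0 ler_expR mulr_ge0.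
move=> N0 kd; rewrite -{1 2 3}(card_ord N) => NT alphaN.
have [|phi phi_inj] := @ex_injection k d 'I_v.+1; first by rewrite card_ord.
pose D (s : {ffun 'I_k -> 'I_v.+1}) (i : 'I_N) (c : 'I_k * 'I_v.+1) := c.2 == s c.1.
have col s b w : column_sum (D s) (b, w) = (N * (w == s b))%N.
  by rewrite /column_sum /D /= sum_nat_const card_ord.
(* The column [s b] has private sum [N > alpha] and its rivals in the block have 0, so an accurate
   output determines [s]. *)
have dec s y : (max_err (stream T (lift phi (D s))) y)%:R <= alpha ->
    s = [ffun b => decode 'I_N phi ord0 y b].
  move=> err_le; have errN : (max_err (stream T (lift phi (D s))) y < N)%N.
    by rewrite -(ltr_nat R) (le_lt_trans err_le).
  apply/ffunP => b; rewrite ffunE.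
  have := @decode_sound d T k _ _ phi phi_inj NT (D s) ord0 y b.
  rewrite card_ord N0 => /(_ isT) /(_ _ (s b)); rewrite !col eqxx muln1 => h.
  apply/eqP/negPn/negP => /negPf neq.
  have : (N <= N * (decode 'I_N phi ord0 y b == s b) +
      max_err (stream T (lift phi (D s))) y)%N.
    by apply: h; exists (s b); rewrite col eqxx muln1.
  by rewrite eq_sym neq; lia.
have := @packing R d T M eps delta eps_ge0 delta_ge0 M_private _ N alpha
  (fun s => stream T (lift phi (D s)))
  (stream T (lift phi (D [ffun=> ord0]))) M_accurate.
rewrite card_ffun !card_ord natrX delta0 !mulr0 addr0 mulr1; apply.
  move=> s; rewrite -[leqRHS](card_ord N) -cardsT.
  by apply: hamming_lift => // i; rewrite inE.
by move=> s s' y /dec -> /dec ->.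
Qed.

Lemma fingerprint_bound (k m n : nat) :
  0 < eps -> 0 <= alpha ->
  (0 < k)%N -> (0 < m)%N -> (0 < n)%N -> (k * 2 ^ m <= d)%N ->
  (m * n + k * (m * n + m * n) <= T)%N ->
  36 * alpha <= (m * n)%:R -> 72 * (n%:R * delta) <= 1 ->
  k%:R <= (108 * (n%:R * eps)) ^+ 2.
Proof.
move=> eps_gt0 alpha_ge0 k0 m0 n0 kd mnT alpha_le ndelta.
have half_sums (A B C e : R) : e <= alpha ->
    2^-1 * (C + A) <= 2^-1 * (C + B) + e -> A - 2 * alpha <= B by lra.
pose V := {ffun 'I_m -> bool}; pose I := ('I_m * 'I_n)%type.
have cardI : #|{: I}| = (m * n)%N by rewrite card_prod !card_ord.
have [|phi phi_inj] := @ex_injection k d V.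
  by rewrite card_ffun card_bool card_ord.
rewrite -cardI in mnT.
pose data := {ffun 'I_k * 'I_m -> {ffun 'I_n -> bool}}.
pose D (X : data) (i : I) (c : 'I_k * V) : bool := X (c.1, i.1) i.2 == c.2 i.1.
pose v0 : V := [ffun=> false].
pose v (y : T.-tuple 'I_d) (c : 'I_k * 'I_m) : bool := decode I phi v0 y c.1 c.2.
pose Q (X : data) := pmf M (stream T (lift phi (D X))).
apply: (@fingerprint R k m n _ Q v (expR eps) eps delta _ _ _ _ _ _ _ _ alpha) => //.
- by move=> X y; exact: pmf_ge0.
- by move=> X; exact: pmf_sum1.
- move=> l i X X' XX'; apply: pmf_private => //.
  rewrite -(cards1 (l, i)); apply: hamming_lift => // -[l' i']; rewrite inE xpair_eqE.
  move=> h; apply/funext => -[b w]; rewrite /D /= XX' //=.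
  by move: h; case: (l' == l).
- exact: expR_le1D3x.
- rewrite -[leRHS](expRxMexpNx_1 eps) [leRHS]mulrC ler_wpM2r ?expR_ge0 //.
  exact: expR_ge1Dx.
move=> X; set D0 := D (rows X).
(* An agreement indicator is half of 1 plus the product of two signs. *)
have colE b (w : V) : (column_sum D0 (b, w))%:R =
    2^-1 * ((m * n)%:R + \sum_l sgb R (w l) * total R X (b, l)) :> R.
  rewrite natrM -sum_ord_cst -big_split mulr_sumr natr_sum /=.
  rewrite -[LHS](pair_bigA _ (fun l i => (D0 (l, i) (b, w))%:R : R)) /=.
  apply: eq_bigr => l _; rewrite -[n%:R]mulr1 -sum_ord_cst mulr_sumr -big_split mulr_sumr.
  apply: eq_bigr => i _; rewrite /D0 /D /bit !ffunE /=.
  by case: (X _ _); case: (w l); rewrite /sgb /=; lra.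
apply: le_trans (accurate_pmf (stream T (lift phi D0)) M_accurate) _.
rewrite big_mkcond [leRHS]big_mkcond; apply: ler_sum => y _.
case: ifP => err_le; last by case: ifP => // _; exact: pmf_ge0.
rewrite ifT //; apply/forallP => b.
(* The majority signs give the best column; its sum is at least [m n / 2 > alpha], as [decode_sound]
   demands. *)
pose w : V := [ffun l => 0 <= total R X (b, l)].
have wE l : sgb R (w l) * total R X (b, l) = `|total R X (b, l)|.
  by rewrite ffunE /sgb; case: ger0P; rewrite ?mul1r ?mulN1r.
have abs_ge0 : 0 <= \sum_l `|total R X (b, l)| by apply: sumr_ge0.
have mn0 : 0 < (m * n)%:R :> R by rewrite ltr0n muln_gt0 m0.
have := @decode_sound d T k V I phi phi_inj mnT D0 v0 y b.
rewrite cardI muln_gt0 m0 n0 => /(_ isT) /(_ _ w) h.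
have : (column_sum D0 (b, w))%:R <= (column_sum D0 (b, decode I phi v0 y b))%:R +
    (max_err (stream T (lift phi D0)) y)%:R :> R.
  rewrite -natrD ler_nat; apply: h; exists w; rewrite -(ltr_nat R).
  by rewrite (le_lt_trans err_le) // colE (eq_bigr _ (fun l _ => wE l)); lra.
rewrite !colE (eq_bigr _ (fun l _ => wE l)) /signed_total /v /=.
exact: half_sums.
Qed.

End Bounds.

(** * Choice of parameters *)

Lemma ex_succ_bounds (R : realType) (x : R) : 0 <= x ->
  exists n : nat, x < n.+1%:R <= x + 1.
Proof.
move=> x0; exists (Num.truncn x); have /andP[h1 h2] := truncn_itv x0.
by rewrite h2 -natr1 lerD2r.
Qed.

Lemma ln2_ge_half (R : realType) : 2^-1 <= ln (2 : R).
Proof.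
have e : expR 2^-1 * expR 2^-1 <= 4 :> R.
  by rewrite -expRD (_ : 2^-1 + 2^-1 = 1) ?expR1_le4 //; lra.
have e0 := expR_gt0 (2^-1 : R).
rewrite -[leLHS]expRK ler_ln ?posrE //; nra.
Qed.

Lemma ln_ge_half (R : realType) (x : R) : 2 <= x -> 2^-1 <= ln x.
Proof.
move=> x2; apply: le_trans (ln2_ge_half R) _.
by rewrite ler_ln ?posrE // (lt_le_trans _ x2).
Qed.

Lemma ln2_le1 (R : realType) : ln (2 : R) <= 1.
Proof. by rewrite (_ : 2 = 1 + 1) ?le_ln1Dx //; lra. Qed.

(** If [alpha] were below the bound, packing with [N] just above [alpha], [k] about [64 eps N / l]
    and [v = d / k] would be contradictory. The first term of the rate makes the stream long enough
    and [4 k <= q], the second gives [4 k <= d], the third [3 N <= T]. *)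
Lemma pure_lower_bound (R : realType) (d T : nat) (M : mechanism R d T)
    (eps delta alpha : R) :
  0 < eps -> eps <= 1 -> (1 < d)%N -> diff_private eps delta M ->
  accurate alpha M -> 1 <= alpha -> delta = 0 ->
  1 / 2048 * pure_rate eps d T <= alpha.
Proof.
move=> eps_gt0 eps1 d_gt1 M_private M_accurate alpha1 delta0.
have [c cE] : exists c : R, c = 1 / 2048 by exists (1 / 2048).
rewrite -cE leNgt; apply/negP => alpha_lt.
have eps_ge0 := ltW eps_gt0.
have delta_ge0 : 0 <= delta by rewrite delta0.
have alpha0 : 0 <= alpha by exact: le_trans ler01 alpha1.
have c0 : 0 < c by rewrite cE; lra.
set q := Num.sqrt (eps * T%:R); set l := ln (2 + d%:R / q).
have T0 : 0 <= T%:R :> R by rewrite ler0n.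
have d2 : 2 <= d%:R :> R by rewrite ler_nat.
have q0 : 0 <= q by rewrite sqrtr_ge0.
have dq0 : 0 <= d%:R / q by rewrite divr_ge0.
have qq : q ^+ 2 = eps * T%:R by rewrite sqr_sqrtr // mulr_ge0.
have l_ge : 2^-1 <= l by apply: ln_ge_half; rewrite lerDl.
have Tl0 : 0 <= T%:R / eps * l by rewrite mulr_ge0 ?divr_ge0 //; lra.
have H1 : alpha <= c * Num.sqrt (T%:R / eps * l).
  by rewrite (le_trans (ltW alpha_lt)) // ler_wpM2l ?(ltW c0) // /pure_rate !ge_min lexx.
have H2 : eps * alpha <= c * d%:R.
  rewrite mulrC -ler_pdivlMr // -mulrA (le_trans (ltW alpha_lt)) // ler_wpM2l ?(ltW c0) //.
  by rewrite /pure_rate !ge_min lexx orbT.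
have H3 : alpha <= c * T%:R.
  by rewrite (le_trans (ltW alpha_lt)) // ler_wpM2l ?(ltW c0) // /pure_rate !ge_min lexx !orbT.
have {}H1 : eps * alpha ^+ 2 <= c ^+ 2 * (T%:R * l).
  have : alpha ^+ 2 <= (c * Num.sqrt (T%:R / eps * l)) ^+ 2.
    by rewrite ler_pXn2r ?nnegrE // ?(le_trans _ alpha_ge1) // mulr_ge0 ?sqrtr_ge0 ?ltW.
  rewrite exprMn sqr_sqrtr // => /(ler_wpM2l eps_ge0) /le_trans; apply.
  have -> : eps * (c ^+ 2 * (T%:R / eps * l)) = c ^+ 2 * (T%:R * l).
    by field; rewrite gt_eqF.
  exact: lexx.
clear alpha_lt Tl0.
have [|N' /andP[aN Na]] := @ex_succ_bounds R alpha; first by [].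
set N := N'.+1 in aN Na; have N0 : (0 < N)%N by [].
have {}Na : N%:R <= 2 * alpha by clear -Na alpha1; lra.
have packed k v := @packing_bound R d T M eps delta alpha eps_ge0 eps1 delta_ge0
  M_private M_accurate k v N delta0 N0.
have T3 : (N + 1 * (N + N) <= T)%N.
  rewrite -(ler_nat R) !natrD natrM natrD; move: H3; rewrite cE; clear -Na T0; lra.
(* For small [eps N] a single block of two columns suffices: [4/3 <= e ^ (1/16)] is false. *)
have [small|big] := leP (eps * N%:R) (1 / 16).
  have := packed 1%N 2%N; rewrite expr1 => /(_ d_gt1 T3 aN).
  have := @expR_le1D3x R (N%:R * eps); rewrite mulrC in small.
  have Ne0 : 0 <= N%:R * eps by rewrite mulr_ge0.
  by move=> /(_ Ne0); clear -small; lra.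
have l0 : 0 < l by clear -l_ge; lra.
set u := 64 * (eps * N%:R) / l.
have u0 : 0 <= u by rewrite divr_ge0 ?(ltW l0) // !mulr_ge0.
have ul : u * l = 64 * (eps * N%:R) by rewrite /u mulfVK // gt_eqF.
have [k' /andP[uk ku]] := ex_succ_bounds u0.
set k := k'.+1 in uk ku; have k0 : (0 < k)%N by [].
have eN : eps * N%:R <= 2 * (eps * alpha) by rewrite mulrCA ler_wpM2l.
have k_bounds : k = 1%N \/ 1 <= u /\ k%:R <= 2 * u.
  have [u1|u1] := ltP u 1; [left|right; clear -u1 ku; lra].
  suff : (k < 2)%N by rewrite /k !ltnS leqn0 => /eqP ->.
  by rewrite -(ltr_nat R); clear -ku u1; lra.
have k_room : k = 1%N \/ 4 * k%:R <= d%:R :> R.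
  case: k_bounds => [|[u1 ku2]]; [by left|right].
  have : u * 2^-1 <= u * l by rewrite ler_wpM2l.
  rewrite ul => h; have h2 := H2; rewrite cE in h2.
  by clear -h h2 ku2 eN; lra.
have k_time : (N + k * (N + N) <= T)%N.
  case: k_bounds => [->//|[u1 ku2]].
  rewrite -(ler_nat R) natrD natrM natrD.
  have h : u * N%:R * l <= 256 * c ^+ 2 * T%:R * l.
    rewrite mulrAC ul.
    have : eps * N%:R ^+ 2 <= eps * (2 * alpha) ^+ 2.
      by rewrite ler_wpM2l // ler_pXn2r // ?nnegrE ?mulr_ge0.
    by rewrite exprMn expr2; move: H1; clear; lra.
  rewrite ler_pM2r // in h.
  have : k%:R * N%:R <= 2 * u * N%:R by rewrite ler_wpM2r.
  have : 1 * N%:R <= u * N%:R by rewrite ler_wpM2r.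
  by move: h; rewrite cE; clear -T0; lra.
set v := (d %/ k)%N.
(* The fourth power absorbs the summand 2 and the rounding in [v]; it yields [l <= 4 * ln v]. *)
have v_ge : (2 + d%:R / q) <= v%:R ^+ 4 :> R.
  have q1 : 1 <= q.
    rewrite -(@ler_pXn2r _ 2) ?nnegrE ?ler01 // qq expr1n.
    have : eps * alpha <= eps * (c * T%:R) by rewrite ler_wpM2l.
    by move: big eN; rewrite cE; clear; lra.
  have q_gt0 : 0 < q by clear -q1; lra.
  have one : k = 1%N -> 2 + d%:R / q <= v%:R ^+ 4.
    move=> k1; rewrite /v k1 divn1.
    have h : d%:R / q <= d%:R by rewrite ler_pdivrMr // ler_peMr.
    have h4 : 4 <= d%:R ^+ 2 :> R by rewrite expr2; clear -d2; nra.
    have -> : d%:R ^+ 4 = d%:R ^+ 2 * d%:R ^+ 2 :> R by rewrite -exprD.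
    have : d%:R <= d%:R ^+ 2 :> R by rewrite expr2; clear -d2; nra.
    by clear -h h4 d2; nra.
  case: k_room => [/one //|k4]; case: k_bounds => [/one //|[u1 ku2]].
  have k_q : 4 * k%:R <= q.
    rewrite -(@ler_pXn2r _ 2) ?nnegrE // ?mulr_ge0 //.
    have u_le : (u * l) ^+ 2 <= (128 * (eps * alpha)) ^+ 2.
      have ea0 : 0 <= 128 * (eps * alpha) by rewrite !mulr_ge0.
      by rewrite ler_pXn2r // ?nnegrE // ?(mulr_ge0 u0 (ltW l0)) // ul; clear -eN; lra.
    have : eps * (eps * alpha ^+ 2) <= eps * (c ^+ 2 * (T%:R * l)) by rewrite ler_wpM2l.
    move=> h; have {u_le h} : u ^+ 2 * l * l <= 128 ^+ 2 * c ^+ 2 * q ^+ 2 * l.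
      by rewrite qq; move: u_le h; rewrite !exprMn !expr2; clear; lra.
    rewrite ler_pM2r // => h.
    have h2 : u ^+ 2 * 2^-1 <= u ^+ 2 * l by rewrite ler_wpM2l // sqr_ge0.
    have : k%:R ^+ 2 <= (2 * u) ^+ 2 by rewrite ler_pXn2r // nnegrE // mulr_ge0.
    by have := sqr_ge0 q; move: h h2; rewrite cE; clear -ku2; lra.
  have dv : d%:R <= (v%:R + 1) * k%:R :> R.
    by rewrite natr1 -natrM ler_nat ltnW // ltn_ceil.
  have v4 : 4 <= v%:R :> R.
    rewrite ler_nat /v leq_divRL //; rewrite -(ler_nat R) natrM //.
  have : d%:R / q <= (v%:R + 1) / 4.
    rewrite ler_pdivrMr //.
    have : (v%:R + 1) * (4 * k%:R) <= (v%:R + 1) * q by rewrite ler_wpM2l // addr_ge0.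
    clear -dv k_q v4; lra.
  have -> : v%:R ^+ 4 = v%:R ^+ 2 * v%:R ^+ 2 :> R by rewrite -exprD.
  have : 4 * v%:R <= v%:R ^+ 2 :> R by rewrite expr2 ler_wpM2r.
  by clear -v4; nra.
have v0 : 0 < v%:R :> R.
  rewrite ltr0n; case: (v) v_ge => // h; move: h; rewrite expr0n /=; clear -dq0; lra.
have lv : l <= 4 * ln v%:R.
  have -> : 4 * ln v%:R = ln (v%:R ^+ 4) :> R by rewrite lnXn // mulr_natl.
  rewrite ler_ln ?posrE ?exprn_gt0 //; exact: ltr_wpDr.
have := packed k v; rewrite mulnC leq_divM => /(_ isT k_time aN).
apply/negP; rewrite -ltNge -[v%:R]lnK ?posrE // -expRM_natl.
(* From [k l > 64 eps N] and [l <= 4 * ln v]. The surplus factor [e ^ (15 eps N) >= 31/16] then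
   beats 3/2. *)
have : expR (16 * (N%:R * eps)) <= expR (k%:R * ln v%:R).
  rewrite ler_expR.
  have : u * l <= k%:R * l by rewrite ler_wpM2r ?ltW.
  have : k%:R * l <= k%:R * (4 * ln v%:R) by rewrite ler_wpM2l.
  rewrite ul; clear -uk; lra.
have -> : 16 * (N%:R * eps) = N%:R * eps + 15 * (N%:R * eps) by ring.
rewrite expRD; have := expR_ge1Dx (15 * (N%:R * eps)); have := expR_gt0 (N%:R * eps).
set E := expR (N%:R * eps); set F := expR (15 * _) => E0 F_ge EF.
have : E * (31 / 16) <= E * F by rewrite ler_wpM2l ?ltW //; clear -F_ge big; lra.
by clear -EF E0; lra.
Qed.

(** * Time and column budgets for approximate privacy *)

Lemma cubic_budget (R : realFieldType) (r N w g e L T : R) :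
  0 <= N -> 0 <= w -> 0 <= r -> 0 <= g -> N * w <= r * g ->
  g ^+ 3 * e ^+ 2 <= T * L ^+ 2 ->
  (N * w) ^+ 3 * e ^+ 2 <= r ^+ 3 * (T * L ^+ 2).
Proof.
move=> N0 w0 r0 g0 Nw geT.
apply: (@le_trans _ _ ((r * g) ^+ 3 * e ^+ 2)).
  by rewrite ler_wpM2r ?sqr_ge0 // ler_pXn2r // nnegrE mulr_ge0.
by rewrite exprMn -mulrA ler_wpM2l // exprn_ge0.
Qed.

(** The case [m = 1], [n = N]: the time is of order [N ^ 3 e ^ 2], and the logarithmic loss [w] pays
    for [L]. The factor 500 covers all constants. *)
Lemma few_bits_budget (R : realFieldType) (r N w e L T : R) :
  0 <= N -> (500 * r) ^+ 3 <= 1 -> 0 <= r -> 2^-1 <= w -> 0 <= L -> L <= 4 * w ->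
  0 <= T -> (N * w) ^+ 3 * e ^+ 2 <= r ^+ 3 * (T * L ^+ 2) ->
  12 * ((108 * (N * e)) ^+ 2 * N) <= T.
Proof.
move=> N0 r1 r0 w_ge L0 Lw T0 h; have w0 : 0 < w by clear -w_ge; lra.
have L2 : r ^+ 3 * (T * L ^+ 2) <= r ^+ 3 * (T * (4 * w) ^+ 2).
  rewrite ler_wpM2l ?exprn_ge0 // ler_wpM2l // ler_pXn2r // nnegrE //.
  by rewrite mulr_ge0 // ltW.
have : (N ^+ 3 * e ^+ 2 * w) * w ^+ 2 <= (16 * r ^+ 3 * T) * w ^+ 2.
  by clear -h L2; lra.
rewrite ler_pM2r ?exprn_gt0 // => {L2} {}h.
have NT : 0 <= N ^+ 3 * e ^+ 2 := mulr_ge0 (exprn_ge0 3 N0) (sqr_ge0 e).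
have wN : N ^+ 3 * e ^+ 2 * 2^-1 <= N ^+ 3 * e ^+ 2 * w.
  by rewrite ler_wpM2l.
have rT : T * (500 * r) ^+ 3 <= T * 1 by rewrite ler_wpM2l.
by clear -h wN rT NT; lra.
Qed.

(** Here [n] is of order [N / L], so the factor [L ^ 2] of the rate is gained through [n ^ 2]. *)
Lemma many_bits_budget (R : realFieldType) (r N n w e L T : R) :
  0 <= N -> (500 * r) ^+ 3 <= 1 -> 0 <= r -> 0 <= n -> 2^-1 <= w -> 0 < L ->
  n * L <= 8 * N -> 0 <= T ->
  (N * w) ^+ 3 * e ^+ 2 <= r ^+ 3 * (T * L ^+ 2) ->
  12 * ((108 * (n * e)) ^+ 2 * N) <= T.
Proof.
move=> N0 r1 r0 n0 w_ge L0 nL T0 h; have w0 : 0 <= w by clear -w_ge; lra.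
have Nw : (N * 2^-1) ^+ 3 * e ^+ 2 <= (N * w) ^+ 3 * e ^+ 2.
  rewrite ler_wpM2r ?sqr_ge0 // ler_pXn2r // ?nnegrE ?mulr_ge0 //.
  by rewrite ler_wpM2l.
have nL2 : (n * L) ^+ 2 * (N * e ^+ 2) <= (8 * N) ^+ 2 * (N * e ^+ 2).
  have NE : 0 <= N * e ^+ 2 := mulr_ge0 N0 (sqr_ge0 e).
  by rewrite (ler_wpM2r NE) // ler_pXn2r // nnegrE mulr_ge0 // ltW.
have L2 : 0 < L ^+ 2 by rewrite exprn_gt0.
rewrite -(ler_pM2r L2).
have rT : T * L ^+ 2 * (500 * r) ^+ 3 <= T * L ^+ 2 * 1.
  by rewrite ler_wpM2l // mulr_ge0 // ltW.
have TL : 0 <= N ^+ 3 * e ^+ 2 := mulr_ge0 (exprn_ge0 3 N0) (sqr_ge0 e).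
by clear -h Nw nL2 rT TL; lra.
Qed.

Lemma powR_cube (R : realType) (x : R) (n : nat) : 0 <= x ->
  (x `^ (n%:R / 3)) ^+ 3 = x ^+ n.
Proof.
move=> x0; rewrite -powR_mulrn ?powR_ge0 // -powRrM mulfVK ?pnatr_eq0 //.
exact: powR_mulrn.
Qed.

Lemma approx_rate_bounds (R : realType) (eps : R) (d T : nat) : 0 < eps -> (1 < d)%N ->
  let g := approx_rate eps d T in
  [/\ 0 <= g, g <= T%:R, (g * eps) ^+ 2 <= d%:R &
      g ^+ 3 * eps ^+ 2 <= T%:R * ln d%:R ^+ 2].
Proof.
move=> eps0 d1 /=; have L0 : 0 <= ln d%:R :> R by rewrite ln_ge0 // ler1n ltnW.
have T0 : 0 <= T%:R :> R by rewrite ler0n.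
have e23 : 0 < eps `^ (2 / 3) by exact: powR_gt0.
set g := approx_rate _ _ _.
have g0 : 0 <= g.
  by rewrite /g /approx_rate !le_min ler0n andbT !mulr_ge0 ?powR_ge0 ?sqrtr_ge0
    ?invr_ge0 ?(ltW eps0) ?powR_ge0.
split => //.
- by rewrite /g /approx_rate !ge_min lexx !orbT.
- have : g * eps <= Num.sqrt d%:R.
    by rewrite -ler_pdivlMr // /g /approx_rate !ge_min lexx !orbT.
  move=> h; rewrite -[leRHS](sqr_sqrtr (ler0n R d)) ler_pXn2r // nnegrE ?sqrtr_ge0 //.
  by rewrite mulr_ge0 // ltW.
have : g * eps `^ (2 / 3) <= T%:R `^ (1 / 3) * ln d%:R `^ (2 / 3).
  by rewrite -ler_pdivlMr // /g /approx_rate !ge_min lexx.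
rewrite -(@ler_pXn2r _ 3) ?nnegrE ?mulr_ge0 ?powR_ge0 //.
by rewrite !exprMn (powR_cube 1) // !(powR_cube 2) ?expr1 // ltW.
Qed.

Lemma ler_of_sqr (R : realFieldType) (a b s : R) : 0 <= a -> 0 <= b -> 0 <= s ->
  a ^+ 2 <= s -> b ^+ 2 <= s -> a * b <= s.
Proof.
move=> a0 b0 s0 ha hb; have := sqr_ge0 (a - b); rewrite sqrrB => h.
lra.
Qed.

(** Taking [k] just above the fingerprinting bound [u] is contradictory once it fits. For [u < 1]
    one block is enough; otherwise [k <= 2 u], which is why [room] is asked only then. *)
Lemma fingerprint_budget (R : realType) (d T : nat) (M : mechanism R d T)
    (eps delta alpha : R) (m n : nat) (N : R) (u := (108 * (n%:R * eps)) ^+ 2) :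
  0 < eps -> eps <= 1 -> 0 <= delta -> diff_private eps delta M -> accurate alpha M ->
  1 <= alpha ->
  (0 < m)%N -> (0 < n)%N -> 36 * alpha <= (m * n)%:R -> (m * n)%:R <= 2 * N ->
  6 * N <= T%:R -> (2 ^ m <= d)%N -> 72 * (n%:R * delta) <= 1 ->
  (1 <= u -> 2 * u * 2 ^+ m <= d%:R /\ 12 * (u * N) <= T%:R) -> False.
Proof.
move=> eps_gt0 eps_le1 delta_ge0 priv acc alpha_ge1 m0 n0 alpha_le mnN NT md ndelta room.
have u0 : 0 <= u by exact: sqr_ge0.
have [k' /andP[uk ku]] := ex_succ_bounds u0.
set k := k'.+1 in uk ku.
have alpha0 : 0 <= alpha by exact: le_trans ler01 alpha_ge1.
have : k%:R <= u; last by rewrite leNgt uk.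
have k_bounds : k = 1%N \/ 1 <= u /\ k%:R <= 2 * u.
  have [u1|u1] := ltP u 1; [left|right; split=> //]; last first.
    by apply: le_trans ku _; rewrite mulr_natl mulr2n lerD2l.
  suff : (k < 2)%N by rewrite /k !ltnS leqn0 => /eqP ->.
  by rewrite -(ltr_nat R) (le_lt_trans ku) // -[2%:R]/(1 + 1) ltrD2r.
apply: (@fingerprint_bound R d T M eps delta alpha (ltW eps_gt0) eps_le1 delta_ge0
  priv acc k m n) => //.
  case: k_bounds => [->|[/room [h _] ku2]]; first by rewrite mul1n.
  rewrite -(ler_nat R) natrM natrX (le_trans _ h) // ler_wpM2r // exprn_ge0 //.
rewrite -(ler_nat R) natrD [X in _ + X]natrM natrD.
have mn0 : 0 <= (m * n)%:R :> R by rewrite ler0n.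
case: k_bounds => [->|[u1 ku2]]; first by clear -mnN NT; lra.
have [_ h] := room u1.
have h1 : k%:R * (m * n)%:R <= 2 * u * (2 * N) by rewrite ler_pM.
have h2 : 1 * (2 * N) <= u * (2 * N).
  by rewrite ler_wpM2r //; exact: le_trans mnN.
by clear -mnN NT h h1 h2; lra.
Qed.

Lemma approx_lower_bound (R : realType) (d T : nat) (M : mechanism R d T)
    (eps delta alpha : R) :
  0 < eps -> eps <= 1 -> 0 <= delta -> (1 < d)%N -> diff_private eps delta M ->
  accurate alpha M -> 1 <= alpha -> 1000 * (T%:R * delta) <= 1 ->
  1 / 1000 / 2000 / 37 * soft 1 (approx_rate eps d T) <= alpha.
Proof.
move=> eps_gt0 eps_le1 delta_ge0 d_gt1 priv acc alpha1 Tdelta.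
rewrite leNgt /soft expr1; apply/negP; set g := approx_rate _ _ _ => alpha_lt.
have [g0 gT gd gTL] := approx_rate_bounds T eps_gt0 d_gt1; rewrite -/g in g0 gT gd gTL.
set w := ln (2 + g) in alpha_lt; set L := ln d%:R in gTL.
have alpha0 : 0 <= alpha by exact: le_trans ler01 alpha1.
have eps_ge0 := ltW eps_gt0.
have w_ge : 2^-1 <= w by apply: ln_ge_half; rewrite lerDl.
have w0 : 0 < w by clear -w_ge; lra.
have L_ge : 2^-1 <= L by apply: ln_ge_half; rewrite ler_nat.
have L0 : 0 < L by clear -L_ge; lra.
have T0 : 0 <= T%:R :> R by rewrite ler0n.
have [r rE] : exists r : R, r = 1 / 1000 / 2000 by exists (1 / 1000 / 2000).
have r0 : 0 <= r by rewrite rE; clear; lra.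
have r_small : (500 * r) ^+ 3 <= 1 by rewrite rE; clear; lra.
have aw : 37 * (alpha * w) <= r * g.
  have : alpha * w <= 1 / 1000 / 2000 / 37 * g.
    by rewrite -ler_pdivlMr // (le_trans (ltW alpha_lt)) // mulrA lexx.
  by rewrite rE; clear; lra.
(* Fingerprinting needs [36 alpha <= m n]; rounding up costs at most one more [alpha], whence the
   37. *)
have [|N' /andP[aN Na]] := @ex_succ_bounds R (36 * alpha); first by rewrite mulr_ge0.
set N := N'.+1 in aN Na; have N_gt0 : (0 < N)%N by [].
have N0 : 0 <= N%:R :> R by rewrite ler0n.
have {}Na : N%:R <= 37 * alpha by clear -Na alpha1; lra.
have Nw : N%:R * w <= r * g.
  apply: le_trans aw; rewrite mulrA; apply: ler_wpM2r Na; exact: ltW.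
have cube := cubic_budget N0 (ltW w0) r0 g0 Nw gTL.
have Ng : N%:R <= 2 * (r * g).
  have : N%:R * 2^-1 <= N%:R * w by rewrite ler_wpM2l.
  by clear -Nw; lra.
have NT : N%:R <= 2 * (r * T%:R).
  by apply: le_trans Ng _; do 2 apply: ler_wpM2l => //.
have {aw Nw} NT6 : 6 * N%:R <= T%:R :> R by move: NT; rewrite rE; clear -T0; lra.
have Nd (n : nat) : n%:R <= 2 * N%:R :> R -> 72 * (n%:R * delta) <= 1.
  move=> nN; have : n%:R * delta <= 2 * (2 * (r * T%:R)) * delta.
    by rewrite ler_wpM2r // (le_trans nN) // ler_wpM2l.
  have Td0 : 0 <= T%:R * delta by rewrite mulr_ge0.
  by move: Tdelta; rewrite rE; clear -Td0; lra.
have Neps : (N%:R * eps) ^+ 2 <= (2 * r) ^+ 2 * d%:R.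
  apply: (@le_trans _ _ ((2 * r) ^+ 2 * (g * eps) ^+ 2)); last first.
    by rewrite ler_wpM2l // sqr_ge0.
  rewrite -exprMn ler_pXn2r ?nnegrE ?mulr_ge0 // mulrA ler_wpM2r //.
  by rewrite -mulrA.
have d0 : 0 < d%:R :> R by rewrite ltr0n ltnW.
(* Either [ln d] is at most [4 w] and one bit suffices, or [d] is large compared with the rate and
   about [ln d] bits fit. *)
have [few|many] := leP d%:R ((2 + g) ^+ 4).
  have Lw : L <= 4 * w.
    have -> : 4 * w = ln ((2 + g) ^+ 4).
      by rewrite lnXn ?mulr_natl // ltr_wpDr.
    by rewrite ler_ln ?posrE // exprn_gt0 // ltr_wpDr.
  apply: (fingerprint_budget (m := 1) (n := N) (N := N%:R) eps_gt0 eps_le1 delta_ge0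
    priv acc) => //; rewrite ?mul1n ?expn1 //.
  - exact: ltW.
  - by rewrite ler_peMl // ler1n.
  - by apply: Nd; rewrite ler_peMl // ler1n.
  move=> _; split; last first.
    exact: (few_bits_budget N0 r_small r0 w_ge (ltW L0) Lw T0 cube).
  by rewrite expr1 exprMn; move: Neps; rewrite rE; clear -d0; lra.
(* Base 4 keeps [2 ^ m0] below the square root of [d], leaving the other square root for the
   blocks. *)
set m0 := trunc_log 4 d.
have d_gt0 : (0 < d)%N by exact: ltnW.
have m0d : (4 ^ m0 <= d)%N by exact: trunc_logP.
have dm0 : (d < 4 ^ m0.+1)%N by exact: trunc_log_ltn.
have m0_gt0 : (0 < m0)%N.
  rewrite trunc_log_gt0 /= -(ltr_nat R); apply: le_lt_trans many.
  apply: (@le_trans _ _ (2 ^+ 4)); first by rewrite -natrX ler_nat.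
  by rewrite ler_pXn2r ?nnegrE ?addr_ge0 // lerDl.
have Lm0 : L <= 4 * m0%:R.
  have : L <= ln (2 ^+ (2 * m0.+1)).
    by rewrite ler_ln ?posrE ?exprn_gt0 // exprM -!natrX ler_nat ltnW.
  rewrite lnXn // -[_ *+ (2 * _)]mulr_natr natrM => h; apply: le_trans h _.
  apply: (@le_trans _ _ (1 * (2 * m0.+1%:R))); first by rewrite ler_wpM2r // ln2_le1.
  have : 1 <= m0%:R :> R by rewrite ler1n.
  by rewrite -natr1; clear; lra.
set m := minn m0 N.
have m_gt0 : (0 < m)%N by rewrite leq_min m0_gt0.
set n := (N %/ m).+1.
have mN : (m <= N)%N by exact: geq_minr.
have Nmn : (N <= m * n)%N by rewrite mulnC ltnW // ltn_ceil.
have mnN : (m * n <= 2 * N)%N.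
  by rewrite mulnS mul2n -addnn leq_add // mulnC leq_divM.
have nN : n%:R <= 2 * N%:R :> R.
  by rewrite -natrM ler_nat; apply: leq_trans mnN; rewrite leq_pmull.
apply: (fingerprint_budget (m := m) (n := n) (N := N%:R) eps_gt0 eps_le1 delta_ge0 priv acc) => //.
- by apply: le_trans (ltW aN) _; rewrite ler_nat.
- by rewrite -natrM ler_nat.
- apply: leq_trans m0d; apply: (@leq_trans (2 ^ m0)); first by rewrite leq_exp2l // geq_minl.
  by rewrite (_ : 4 = 2 ^ 2)%N // -expnM leq_exp2l // mul2n -addnn leq_addr.
- exact: Nd.
move=> _; set u := (108 * (n%:R * eps)) ^+ 2.
have u0 : 0 <= u by exact: sqr_ge0.
split.
  apply: ler_of_sqr; [by rewrite mulr_ge0|by rewrite exprn_ge0|exact: ltW| |]; last first.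
    rewrite -exprM mulnC exprM -!natrX ler_nat; apply: leq_trans m0d.
    by rewrite leq_exp2l // geq_minl.
  apply: le_trans (ltW many).
  rewrite (_ : (2 + g) ^+ 4 = ((2 + g) ^+ 2) ^+ 2); last by rewrite -exprM.
  rewrite ler_pXn2r // ?nnegrE ?sqr_ge0 ?mulr_ge0 //.
  have ng : n%:R * eps <= 4 * (r * g).
    apply: (@le_trans _ _ (n%:R * 1)); first by rewrite ler_wpM2l.
    by move: nN Ng; clear; lra.
  have : (108 * (n%:R * eps)) ^+ 2 <= (108 * (4 * (r * g))) ^+ 2.
    by rewrite ler_pXn2r ?nnegrE ?mulr_ge0 // ler_wpM2l.
  by rewrite -/u; have := sqr_ge0 g; move: g0; rewrite rE; clear; lra.
have [m0N|Nm0] := leqP m0 N.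
  have mE : m = m0 by exact: minn_idPl.
  apply: (many_bits_budget N0 r_small r0 _ w_ge L0 _ T0 cube) => //.
  apply: (@le_trans _ _ (n%:R * (4 * m0%:R))); first by rewrite ler_wpM2l.
  have : (m * n)%:R <= (2 * N)%:R :> R by rewrite ler_nat.
  by rewrite mE !natrM; clear; lra.
(* With [m] capped at [N] the groups have two records, so [u] is bounded by a constant and the time
   is linear in [N]. *)
have n2 : n = 2%N by rewrite /n /m (minn_idPr (ltnW Nm0)) divnn N_gt0.
have u_le : u <= (108 * 2) ^+ 2.
  by rewrite /u n2 ler_pXn2r ?nnegrE ?mulr_ge0 // ler_wpM2l // ler_piMr.
have : u * N%:R <= (108 * 2) ^+ 2 * N%:R by rewrite ler_wpM2r.
by move: NT; rewrite rE; clear -T0; lra.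
Qed.

(* Either d >= eps T, and then 2 + d / sqrt (eps T) >= sqrt d, or d < eps T, and
   then the rate itself is at least of order sqrt d; so ln d is absorbed by one of
   the two logarithms. *)
Lemma pure_simple_rate_le (R : realType) (eps : R) (d T : nat) :
  0 < eps -> eps <= 1 -> (1 < d)%N -> (0 < T)%N ->
  1 / 4 * soft 1 (pure_simple_rate eps d T) <= pure_rate eps d T.
Proof.
move=> eps0 eps1 d1 T1; rewrite /soft expr1; set b := pure_simple_rate _ _ _.
set w := ln (2 + b); set L := ln d%:R : R; set q := Num.sqrt (eps * T%:R).
set l := ln (2 + d%:R / q).
have d2 : 2 <= d%:R :> R by rewrite ler_nat.
have d_gt0 : 0 < d%:R :> R by exact: lt_le_trans d2.
have T0 : 0 < T%:R :> R by rewrite ltr0n.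
have L_ge : 2^-1 <= L by exact: ln_ge_half.
have L0 : 0 < L by clear -L_ge; lra.
have TL0 : 0 <= T%:R * L / eps by rewrite !mulr_ge0 ?invr_ge0 ?ltW.
have b0 : 0 <= b.
  by rewrite /b /pure_simple_rate !le_min sqrtr_ge0 divr_ge0 ?ler0n // ltW.
have b_L : b ^+ 2 <= T%:R * L / eps.
  rewrite -[leRHS]sqr_sqrtr // ler_pXn2r ?nnegrE ?sqrtr_ge0 //.
  by rewrite /b /pure_simple_rate !ge_min lexx.
have b_d : b <= d%:R / eps by rewrite /b /pure_simple_rate !ge_min lexx orbT.
have b_T : b <= T%:R by rewrite /b /pure_simple_rate !ge_min lexx !orbT.
have w_ge : 2^-1 <= w by apply: ln_ge_half; rewrite lerDl.
have w0 : 0 < w by clear -w_ge; lra.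
have q0 : 0 < q by rewrite sqrtr_gt0 mulr_gt0.
have qq : q ^+ 2 = eps * T%:R by rewrite sqr_sqrtr // mulr_ge0 // ltW.
have l_ge : 2^-1 <= l by apply: ln_ge_half; rewrite lerDl divr_ge0 // ltW.
have bw : b / w <= 2 * b.
  by rewrite ler_pdivrMr // -mulrA mulrCA; clear -b0 w_ge; nra.
have L_or : L <= 2 * l \/ L <= 3 * w.
  have [dq|dq] := leP (q ^+ 2) d%:R.
    have dq0 : 0 <= d%:R / q by rewrite divr_ge0 // ltW.
    have s0 : 0 < 2 + d%:R / q by exact: ltr_wpDr.
    left; have -> : 2 * l = ln ((2 + d%:R / q) ^+ 2) by rewrite lnXn // mulr_natl.
    rewrite ler_ln ?posrE // ?exprn_gt0 //.
    apply: (@le_trans _ _ ((d%:R / q) ^+ 2)).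
      by rewrite expr_div_n ler_pdivlMr ?exprn_gt0 // [leRHS]expr2 ler_wpM2l.
    by rewrite ler_pXn2r ?nnegrE ?addr_ge0 // lerDr.
  have s0 : 0 < 2 + b by exact: ltr_wpDr.
  right; have -> : 3 * w = ln ((2 + b) ^+ 3) by rewrite lnXn // mulr_natl.
  rewrite ler_ln ?posrE // ?exprn_gt0 //.
  have dT : d%:R <= T%:R :> R.
    by rewrite (le_trans (ltW dq)) // qq ler_piMl // ltW.
  (* If the minimum is [d / eps] or [T], then [d <= b]; otherwise [b ^ 2 = T L / eps >= T / 2]. *)
  have b_ge : d%:R <= b \/ d%:R <= 2 * b ^+ 2.
    have [|hmin] : b = Num.sqrt (T%:R * L / eps) \/ d%:R <= b.
      rewrite /b /pure_simple_rate; set x := Num.sqrt _; set y := d%:R / eps.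
      have [_|_] := leP (Num.min x y) T%:R; last by right.
      have [_|_] := leP x y; [by left|right].
      by rewrite ler_pdivlMr // ler_piMr // ltW.
    - move=> bE; right; rewrite bE sqr_sqrtr //.
      have : T%:R * 2^-1 <= T%:R * L by rewrite ler_wpM2l // ltW.
      have : T%:R * L <= T%:R * L / eps.
        by rewrite ler_pdivlMr // ler_piMr // mulr_ge0 // ltW.
      by clear -dT; lra.
    by left.
  have b3 : 0 <= b ^+ 3 by rewrite exprn_ge0.
  have b2 : 0 <= b ^+ 2 by rewrite exprn_ge0.
  by clear -b0 b_ge b2 b3; case: b_ge; lra.
have half (x y : R) : x <= 2 * y -> 0 <= y -> 1 / 4 * x <= y by clear; lra.
rewrite /pure_rate !le_min -andbA; apply/and3P; split; last 2 first.
- by apply: le_trans b_d; exact: half.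
- by apply: le_trans b_T; exact: half.
have bw0 : 0 <= b / w by rewrite divr_ge0 // ltW.
have Te0 : 0 <= T%:R / eps by rewrite divr_ge0 // ltW.
have TL : T%:R * L / eps = T%:R / eps * L by rewrite mulrAC.
have l0 : 0 <= l by clear -l_ge; lra.
have Tel0 : 0 <= T%:R / eps * l by exact: mulr_ge0.
rewrite -(@ler_pXn2r _ 2) ?nnegrE ?sqrtr_ge0 // ?mulr_ge0 ?invr_ge0 ?(ltW w0) //.
rewrite sqr_sqrtr // -/q -/l.
case: L_or => [Ll|Lw].
  have : (b / w) ^+ 2 <= (2 * b) ^+ 2 by rewrite ler_pXn2r ?nnegrE // mulr_ge0.
  have : T%:R / eps * L <= T%:R / eps * (2 * l) by rewrite ler_wpM2l.
  by rewrite -TL; clear -b_L Tel0; lra.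
have bT : b ^+ 2 <= 3 * w * (T%:R / eps).
  by apply: le_trans b_L _; rewrite TL mulrC ler_wpM2r.
have ww : 2^-1 * w <= w ^+ 2 by rewrite expr2 ler_wpM2r // ltW.
have h1 : T%:R / eps * (2^-1 * w) <= T%:R / eps * w ^+ 2 by rewrite ler_wpM2l.
have h2 : w ^+ 2 * (T%:R / eps * 2^-1) <= w ^+ 2 * (T%:R / eps * l).
  by rewrite ler_wpM2l ?sqr_ge0 // ler_wpM2l.
have h3 : 0 <= w ^+ 2 * (T%:R / eps) by rewrite mulr_ge0 ?sqr_ge0.
have -> : (1 / 4 * (b / w)) ^+ 2 = 1 / 16 * b ^+ 2 / w ^+ 2.
  by field; rewrite gt_eqF.
rewrite ler_pdivrMr ?exprn_gt0 //.
by clear -bT h1 h2 h3; lra.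
Qed.

(* The constants c and p are absolute.  The hypothesis delta = o(eps / T) is
   delta <= r T * (eps / T) for a rate r tending to 0; "sufficiently large T"
   depends on the rate r only (part (2), not involving r, may be read with
   r = 0, i.e. with an absolute threshold).  The chain
   alpha = \Omega(A) = \tilde\Omega(B) of part (2) is spelled out as
   alpha = \Omega(A), A = \tilde\Omega(B) and alpha = \tilde\Omega(B). *)
Theorem theorem4p1 (R : realType) :
  exists (c : R) (p : nat), 0 < c /\
  forall r : nat -> R, r n @[n --> \oo] --> (0 : R) ->
  \forall T \near \oo,
  forall (eps delta alpha : R) (d : nat) (M : mechanism R d T),
    0 < eps -> eps <= 1 ->
    0 <= delta -> delta < 1 ->
    0 < alpha ->
    (1 < d)%N ->
    diff_private eps delta M ->
    accurate alpha M ->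
    (0 < delta -> delta <= r T * (eps / T%:R) ->
       c * soft p (approx_rate eps d T) <= alpha)
    /\
    (delta = 0 ->
       [/\ c * pure_rate eps d T <= alpha,
           c * soft p (pure_simple_rate eps d T) <= pure_rate eps d T &
           c * soft p (pure_simple_rate eps d T) <= alpha]).
Proof.
have c_pos : 0 < 1 / 1000 / 2000 / 37 :> R by lra.
(* This constant of the approximate case is below [1 / 2048] and even [1 / 8192], the product of the
   two pure constants, so it serves all claims. *)
exists (1 / 1000 / 2000 / 37), 1%N; split=> // r r_cvg.
have soft_ge0 (x : R) : 0 <= x -> 0 <= soft 1 x.
  move=> x0; rewrite /soft expr1 divr_ge0 // ln_ge0 //.
  by apply: (@le_trans _ _ 2); rewrite ?ler1n // lerDl.
have r_near : \forall T \near \oo, r T <= 1 / 1000.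
  move/cvgrPdist_lt: r_cvg => /(_ (1 / 1000)) r_cvg.
  near=> T; have : `|0 - r T| < 1 / 1000 by near: T; apply: r_cvg; lra.
  by rewrite sub0r normrN => /ltW /(le_trans (ler_norm _)).
near=> T => eps delta alpha d M eps0 eps1 delta0 delta1 alpha0 d1 priv acc.
have T80 : (80 <= T)%N by near: T; exact: nbhs_infty_ge.
have rT : r T <= 1 / 1000 by near: T.
have T1 : (0 < T)%N by exact: leq_trans T80.
have T0 : 0 < T%:R :> R by rewrite ltr0n.
have ge1 : delta <= 1 / 1000 -> 1 <= alpha.
  by move=> dl; exact: (accuracy_ge1 (ltW eps0) eps1 delta0 dl d1 T80 priv acc).
split.
  move=> _ delta_le.
  have Td : 1000 * (T%:R * delta) <= 1.
    have : T%:R * delta <= r T * eps.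
      rewrite mulrC -ler_pdivlMr // -mulrA //.
    have : r T * eps <= 1 / 1000 * eps by rewrite ler_wpM2r // ltW.
    by clear -eps1 eps0; lra.
  apply: (approx_lower_bound eps0 eps1 delta0 d1 priv acc _ Td).
  apply: ge1.
  have : 1 * delta <= T%:R * delta by rewrite ler_wpM2r // ler1n.
  by clear -Td; lra.
move=> dz.
have alpha1 : 1 <= alpha by apply: ge1; rewrite dz; lra.
have pure := pure_lower_bound eps0 eps1 d1 priv acc alpha1 dz.
have simple := pure_simple_rate_le eps0 eps1 d1 T1.
have A0 : 0 <= pure_rate eps d T.
  by rewrite /pure_rate !le_min sqrtr_ge0 ler0n divr_ge0 // ltW.
have B0 : 0 <= soft 1 (pure_simple_rate eps d T).
  by apply: soft_ge0; rewrite /pure_simple_rate !le_min sqrtr_ge0 ler0n divr_ge0 // ltW.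
move: pure simple A0 B0; set A := pure_rate _ _ _; set B := soft _ _.
by clear; split; lra.
Unshelve. all: by end_near.
Qed.
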